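(* The intersection of all the minimal components of $J(1,d)$ equals $J(1,d) + \left(sc_2(b_1^d-b_2^d)\right)$.
   Context: Let $K$ be a field and $d$ a positive integer. If the characteristic of $K$ is a positive prime $p$, write $d = d'i$, where $i$ is a power of $p$ (possibly $i=1$) and $d'$ and $p$ are relatively prime; if the characteristic of $K$ is zero, let $d'=d$ and $i=1$. Assume that $K$ contains all the $\frac{d}{i}$th roots of unity. Let $R = K[s,f,s_1,f_1,c_1,c_2,c_3,c_4,b_1,b_2,b_3,b_4]$ be the polynomial ring in these $12$ indeterminates. The first Mayr-Meyer ideal is the ideal of $R$ $$ J(1,d) = (s_1-sc_1,\ f_1-sc_4) + \left(c_j(s-fb_j^d) \mid j=1,2,3,4\right) + \left(fc_1-sc_2,\ fc_4-sc_3,\ s(c_3-c_2),\ f(c_2b_1-c_3b_4),\ fc_2(b_2-b_3)\right). $$ The minimal components of an ideal are the (uniquely determined) primary components, in a minimal primary decomposition, belonging to the minimal primes of the ideal. *)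

(* Defs.v *)
(* Ideals are Prop-valued subsets [set R] of a commutative ring R. *)
From HB Require Import structures.
From mathcomp Require Import all_boot all_order all_algebra.
From mathcomp Require Import boolp classical_sets.
From mathcomp Require Import mpoly.
Set Implicit Arguments.
Unset Strict Implicit.
Unset Printing Implicit Defensive.
Import GRing.Theory.
Local Open Scope classical_set_scope.
Local Open Scope ring_scope.

Section Ideals.
Variable R : comNzRingType.
Implicit Types (I J P Q C : set R).

Definition is_ideal I : Prop :=
  [/\ I 0, forall x y, I x -> I y -> I (x + y) & forall a x, I x -> I (a * x)].

Definition ideal_gen (A : set R) : set R := smallest is_ideal A.

Definition ideal_add I J : set R := [set z | exists x y, [/\ I x, J y & z = x + y]].

Definition radical I : set R := [set x | exists n : nat, I (x ^+ n)].

Definition is_prime P : Prop :=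
  [/\ is_ideal P, ~ P 1 & forall x y, P (x * y) -> P x \/ P y].

Definition is_primary Q : Prop :=
  [/\ is_ideal Q, ~ Q 1 & forall x y, Q (x * y) -> Q x \/ radical Q y].

Definition minimal_prime I P : Prop :=
  [/\ is_prime P, I `<=` P
    & forall P', is_prime P' -> I `<=` P' -> P' `<=` P -> P' = P].

(* Minimality of the decomposition: the associated primes are pairwise distinct
   and no component can be omitted. *)
Definition minimal_primary_decomposition I (n : nat) (Q : 'I_n -> set R) : Prop :=
  [/\ I = \bigcap_(k in [set: 'I_n]) Q k,
      forall k, is_primary (Q k),
      injective (fun k => radical (Q k))
    & forall k, ~ (\bigcap_(l in [set~ k]) Q l `<=` Q k)].

Definition minimal_component I : set (set R) :=
  [set C | exists n (Q : 'I_n -> set R) (k : 'I_n),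
     [/\ minimal_primary_decomposition I Q,
         minimal_prime I (radical (Q k)) & C = Q k]].

End Ideals.

(* Every n-th root of unity of every extension field of K comes from K. *)
Definition contains_roots_of_unity (K : fieldType) (n : nat) : Prop :=
  forall (L : fieldType) (iota : {rmorphism K -> L}) (z : L),
    z ^+ n = 1 -> exists y : K, iota y = z.

(* The indeterminates are ordered s, f, s1, f1, c1, .., c4, b1, .., b4; the
   index j of [vc] and [vb] is meant to range over 1, 2, 3, 4. *)
Section Indeterminates.
Variable K : fieldType.

Definition vs : {mpoly K[12]} := 'X_(inord 0).
Definition vf : {mpoly K[12]} := 'X_(inord 1).
Definition vs1 : {mpoly K[12]} := 'X_(inord 2).
Definition vf1 : {mpoly K[12]} := 'X_(inord 3).
Definition vc (j : nat) : {mpoly K[12]} := 'X_(inord (3 + j)).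
Definition vb (j : nat) : {mpoly K[12]} := 'X_(inord (7 + j)).

End Indeterminates.

Definition mayr_meyer1 (K : fieldType) (d : nat) : set {mpoly K[12]} :=
  let s := vs K in let f := vf K in let s1 := vs1 K in let f1 := vf1 K in
  let c := vc K in let b := vb K in
  ideal_gen [set` [:: s1 - s * c 1%N; f1 - s * c 4%N]
               ++ [seq c j * (s - f * b j ^+ d) | j <- [:: 1; 2; 3; 4]%N]
               ++ [:: f * c 1%N - s * c 2%N; f * c 4%N - s * c 3%N;
                      s * (c 3%N - c 2%N);
                      f * (c 2%N * b 1%N - c 3%N * b 4%N);
                      f * c 2%N * (b 2%N - b 3%N)]].
Arguments mayr_meyer1 : clear implicits.

(* Main.v *)
Require Import Defs.
From HB Require Import structures.
From mathcomp Require Import all_boot all_order all_algebra.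
From mathcomp Require Import boolp classical_sets.
From mathcomp Require Import all_field mpoly.
From mathcomp Require Import zify ring.
Set Implicit Arguments.
Unset Strict Implicit.
Unset Printing Implicit Defensive.
Import GRing.Theory.
Local Open Scope classical_set_scope.
Local Open Scope ring_scope.

(** Write [J] for the ideal [mayr_meyer1 K d], [g] for
    [s * c2 * (b1 ^+ d - b2 ^+ d)], and [L] for [J + (g)].  The following five
    kinds of primes are minimal over [J]; each of them also contains
    [s1 - s * c1] and [f1 - s * c4].
    - [(s, f)];
    - [(c1, c2, c3, c4)];
    - [(s, c1, c2, c4, b3, b4)];
    - [(s, c1, c4, b2, b3, c2 * b1 - c3 * b4)];
    - for each [z] in [K] with [z ^+ d' = 1], the prime spanned by
      [s - f * b1 ^+ d], [c1 - c2 * b1 ^+ d], [c4 - c2 * b1 ^+ d], [c3 - c2],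
      [b3 - b2], [b4 - b1] and [b1 - z * b2].

    Each of these primes is the set of the [x] such that [p] divides [phi x], for
    some substitution [phi] and some prime element [p] (possibly 0).  Replacing [p]
    by a suitable power [p ^+ n], with [n] equal to 1, 1, [d], [d] and [i]
    respectively, gives an ideal [Q] that still contains [J] and modulo which the
    elements outside of the prime are regular.  The component of [J] at this prime
    is therefore contained in [Q] (minimal_component_sub).  This presupposes that
    [J] has a minimal primary decomposition, which holds because polynomial rings
    are noetherian (hilbert_basis, lasker).

    An element [x] of all the minimal components is pushed down the chain of ideals
    [J + (f * c2, f * c3)], [J + (f * c2)], [J + (s * c2)], [L].  It lies in the
    first one because it is in the components at [(s, f)] and [(c1, c2, c3, c4)].
    Each of the three other steps uses one of the three other kinds of primes:
    when [x = y + a * h] with [y] in the next ideal and [h] the generator to be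
    removed, [h] is regular modulo [Q], so that [a] is in [Q], and the
    relations defining [J] show that [h * Q] is contained in the next ideal
    (ideal_add_regular and the lemmas colon_fc3, colon_fc2, colon_sc2).  The last
    step involves all the roots of unity [z] at once: the product of the
    [(b1 - z * b2) ^+ i] is [b1 ^+ d - b2 ^+ d] (subrXX_factor).

    Conversely [g] lies in each minimal component [C], because [f * g] is in [J];
    if [f] is in the radical of [C], this radical is [(s, f)] and
    [s * (c3 - c2)], which is in [J], forces [s] into [C] (L_sub_bigcap). *)

(** * Ideals *)

Section IdealTheory.
Variable R : comNzRingType.
Implicit Types (I J P Q : set R) (x y : R).

Lemma ideal_0 I : is_ideal I -> I 0. Proof. by case. Qed.

Lemma ideal_D I x y : is_ideal I -> I x -> I y -> I (x + y).
Proof. by case=> _ + _; apply. Qed.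

Lemma ideal_Ml I a x : is_ideal I -> I x -> I (a * x).
Proof. by case=> _ _; apply. Qed.

Lemma ideal_Mr I a x : is_ideal I -> I x -> I (x * a).
Proof. by rewrite mulrC; apply: ideal_Ml. Qed.

Lemma ideal_N I x : is_ideal I -> I x -> I (- x).
Proof. by rewrite -mulN1r; apply: ideal_Ml. Qed.

Lemma ideal_B I x y : is_ideal I -> I x -> I y -> I (x - y).
Proof. by move=> idI Ix Iy; apply: ideal_D => //; apply: ideal_N. Qed.

Lemma ideal_sum I (T : Type) (r : seq T) (p : pred T) (F : T -> R) :
  is_ideal I -> (forall t, p t -> I (F t)) -> I (\sum_(t <- r | p t) F t).
Proof.
move=> idI IF; apply: big_ind => //; first exact: ideal_0.
by move=> x y; apply: ideal_D.
Qed.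

Lemma ideal_congr I x y : is_ideal I -> I (x - y) -> I y -> I x.
Proof. by move=> idI Ixy Iy; rewrite -(subrK y x); apply: ideal_D. Qed.

Lemma ideal_subrX I x y n : is_ideal I -> I (x - y) -> I (x ^+ n - y ^+ n).
Proof. by move=> idI Ixy; rewrite subrXX; apply: ideal_Mr. Qed.

Lemma bigcap_ideal T (D : set T) (F : T -> set R) :
  (forall t, D t -> is_ideal (F t)) -> is_ideal (\bigcap_(t in D) F t).
Proof.
move=> idF; split=> [t Dt | x y Fx Fy t Dt | a x Fx t Dt].
- by apply: ideal_0; exact: idF.
- by apply: ideal_D; [exact: idF | exact: Fx | exact: Fy].
- by apply: ideal_Ml; [exact: idF | exact: Fx].
Qed.

Lemma ideal_genP A : is_ideal (ideal_gen (R := R) A).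
Proof. by apply: bigcap_ideal => I []. Qed.

Lemma ideal_gen_sub A I : is_ideal I -> A `<=` I -> ideal_gen A `<=` I.
Proof. exact: smallest_sub. Qed.

Lemma sub_ideal_gen A : A `<=` ideal_gen (R := R) A.
Proof. exact: sub_gen_smallest. Qed.

Lemma ideal_addP I J : is_ideal I -> is_ideal J -> is_ideal (ideal_add I J).
Proof.
move=> idI idJ; split.
- by exists 0, 0; split; rewrite ?addr0 //; apply: ideal_0.
- move=> _ _ [x [y [Ix Jy ->]]] [x' [y' [Ix' Jy' ->]]].
  by exists (x + x'), (y + y'); split; [exact: ideal_D.. | rewrite addrACA].
- move=> a _ [x [y [Ix Jy ->]]]; exists (a * x), (a * y).
  by split; [exact: ideal_Ml.. | rewrite mulrDr].
Qed.

Lemma ideal_addl I J : is_ideal J -> I `<=` ideal_add I J.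
Proof. by move=> idJ x Ix; exists x, 0; split; rewrite ?addr0 //; apply: ideal_0. Qed.

Lemma ideal_addr I J : is_ideal I -> J `<=` ideal_add I J.
Proof. by move=> idI x Jx; exists 0, x; split; rewrite ?add0r //; apply: ideal_0. Qed.

Lemma ideal_add_sub I J Q :
  is_ideal Q -> I `<=` Q -> J `<=` Q -> ideal_add I J `<=` Q.
Proof. by move=> idQ IQ JQ _ [x [y [Ix Jy ->]]]; apply: ideal_D; auto. Qed.

Definition principal x : set R := [set y | exists a, y = a * x].

Lemma principalP x : is_ideal (principal x).
Proof.
split=> [|_ _ [a ->] [b ->] | c _ [a ->]]; first by exists 0; rewrite mul0r.
- by exists (a + b); rewrite mulrDl.
- by exists (c * a); rewrite mulrA.
Qed.

Lemma principal_id x : principal x x. Proof. by exists 1; rewrite mul1r. Qed.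

Lemma principal_sub I x : is_ideal I -> I x -> principal x `<=` I.
Proof. by move=> idI Ix _ [a ->]; apply: ideal_Ml. Qed.

Lemma principal_add_ideal I x : is_ideal I -> is_ideal (ideal_add I (principal x)).
Proof. by move=> idI; apply: ideal_addP => //; apply: principalP. Qed.

Lemma principal_add_sub I x : I `<=` ideal_add I (principal x).
Proof. by apply: ideal_addl; apply: principalP. Qed.

Lemma principal_add_id I x : is_ideal I -> ideal_add I (principal x) x.
Proof. by move=> idI; apply: ideal_addr => //; apply: principal_id. Qed.

Lemma principal_add_mono I I' x : is_ideal I' -> I `<=` I' ->
  ideal_add I (principal x) `<=` ideal_add I' (principal x).
Proof.
move=> idI' II'; apply: ideal_add_sub; first exact: principal_add_ideal.
  exact: subset_trans (@principal_add_sub I' x).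
exact: ideal_addr.
Qed.

Definition colon I x : set R := [set y | I (x * y)].

Lemma colonP I x : is_ideal I -> is_ideal (colon I x).
Proof.
move=> idI; split=> [|y z|a y]; rewrite /colon /=.
- by rewrite mulr0; apply: ideal_0.
- by rewrite mulrDr; apply: ideal_D.
- by rewrite mulrCA; apply: ideal_Ml.
Qed.

(** If [x = y + a * g] with [y] in [I], then [a * g] is in [Q], hence so is [a]. *)
Lemma ideal_add_regular I Q g x :
  is_ideal I -> is_ideal Q -> I `<=` Q -> (forall y, Q (y * g) -> Q y) ->
  Q `<=` colon I g -> ideal_add I (principal g) x -> Q x -> I x.
Proof.
move=> idI idQ IQ regQ Qcolon [y [_ [Iy [a ->] ->]]] Qx.
apply: (ideal_D idI) => //; rewrite mulrC; apply: Qcolon; apply: regQ.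
by rewrite -(addKr y (a * g)); apply: (ideal_D idQ) => //; apply: (ideal_N idQ); apply: IQ.
Qed.

(** The next three lemmas reduce membership to a ring identity, the cofactors
    being given explicitly. *)
Lemma ideal_comb1 I a g x :
  is_ideal I -> I g -> x = a * g -> I x.
Proof. by move=> idI Ig ->; apply: ideal_Ml. Qed.

Lemma ideal_comb2 I a1 a2 g1 g2 x :
  is_ideal I -> I g1 -> I g2 -> x = a1 * g1 + a2 * g2 -> I x.
Proof. by move=> idI Ig1 Ig2 ->; apply: (ideal_D idI); apply: (ideal_Ml _ idI). Qed.

Lemma ideal_comb3 I a1 a2 a3 g1 g2 g3 x :
  is_ideal I -> I g1 -> I g2 -> I g3 -> x = a1 * g1 + a2 * g2 + a3 * g3 -> I x.
Proof.
move=> idI Ig1 Ig2 Ig3 ->; apply: (ideal_D idI); last exact: ideal_Ml.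
by apply: (ideal_D idI); apply: (ideal_Ml _ idI).
Qed.

Lemma prime_ideal P : is_prime P -> is_ideal P. Proof. by case. Qed.

Lemma primary_ideal Q : is_primary Q -> is_ideal Q. Proof. by case. Qed.

Lemma prime_cancel P x y : is_prime P -> ~ P y -> P (x * y) -> P x.
Proof. by case=> _ _ prP nPy /prP[]. Qed.

Lemma primeX P x n : is_prime P -> P (x ^+ n) -> P x.
Proof.
case=> _ P1 prP; elim: n => [//|n IH]; rewrite exprS.
by case/prP.
Qed.

Lemma prime_nprod P (T : Type) (r : seq T) (p : pred T) (F : T -> R) :
  is_prime P -> (forall t, p t -> ~ P (F t)) -> ~ P (\prod_(t <- r | p t) F t).
Proof.
move=> [_ P1 prP] nF; apply: (big_ind (fun x => ~ P x)) => // x y nx ny.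
by move/prP => -[].
Qed.

Lemma radical_sub I : I `<=` radical I. Proof. by move=> x Ix; exists 1%N. Qed.

Lemma radical_sub_prime I P : is_prime P -> I `<=` P -> radical I `<=` P.
Proof. by move=> prP IP x [n /IP]; apply: primeX. Qed.

Lemma radical_primary Q : is_primary Q -> is_prime (radical Q).
Proof.
case=> idQ Q1 prQ; split; last 1 first.
- move=> x y [n]; rewrite exprMn => /prQ[Qx|[m]]; first by left; exists n.
  by rewrite -exprM => Qy; right; exists (n * m)%N.
- split; first by exists 1%N; apply: ideal_0.
  + move=> x y [n Qx] [m Qy]; exists (n + m)%N; rewrite exprDn.
    apply: ideal_sum => // k _; rewrite -mulr_natl; apply: ideal_Ml => //.
    have [le_mk | lt_km] := leqP m k.
      by rewrite -(subnK le_mk) exprD mulrA; apply: ideal_Ml.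
    rewrite -addnBA ?(ltnW lt_km) // exprD mulrAC.
    by apply: ideal_Mr => //; apply: ideal_Mr.
  + by move=> a x [n Qx]; exists n; rewrite exprMn; apply: ideal_Ml.
- by case=> n; rewrite expr1n.
Qed.

Lemma primary_cancel Q x y : is_primary Q -> ~ radical Q y -> Q (x * y) -> Q x.
Proof. by case=> _ _ prQ nQy /prQ[]. Qed.

Lemma primaryI Q Q' : is_primary Q -> is_primary Q' ->
  radical Q = radical Q' -> is_primary (Q `&` Q').
Proof.
move=> [idQ Q1 prQ] [idQ' Q1' prQ'] rQQ'.
have radI z : radical Q z -> radical (Q `&` Q') z.
  move=> rz; have := rz; rewrite [in X in X -> _]rQQ' => -[m Q'z].
  case: rz => n Qz; exists (n + m)%N; rewrite exprD.
  by split; [exact: ideal_Mr | exact: ideal_Ml].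
split; last 1 first.
- move=> x y [/prQ[Qx|/radI]]; last by right.
  by case/prQ' => [Q'x|]; [left | rewrite -rQQ'; right; apply: radI].
- split=> [|x y [? ?] [? ?]|a x [? ?]].
  + by split; apply: ideal_0.
  + by split; apply: ideal_D.
  + by split; apply: ideal_Ml.
- by case.
Qed.

End IdealTheory.

(** * Noetherian rings *)

Section Noetherian.
Variable R : comNzRingType.

Definition finitely_generated (I : set R) : Prop :=
  exists2 l : seq R, [set` l] `<=` I & I `<=` ideal_gen [set` l].

Definition noetherian : Prop :=
  forall I : set R, is_ideal I -> finitely_generated I.

Lemma chain_le (I : nat -> set R) m n :
  (forall k, I k `<=` I k.+1) -> (m <= n)%N -> I m `<=` I n.
Proof.
move=> incI /subnK <-; elim: (n - m)%N => [//|k IH] x /IH.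
by rewrite addSn; apply: incI.
Qed.

Lemma bigcup_chain_ideal (I : nat -> set R) :
  (forall n, is_ideal (I n)) -> (forall n, I n `<=` I n.+1) ->
  is_ideal (\bigcup_n I n).
Proof.
move=> idI incI; split=> [|x y [m _ Ix] [n _ Iy] | a x [n _ Ix]].
- by exists 0%N => //; apply: ideal_0.
- exists (maxn m n) => //; apply: ideal_D => //.
    exact: chain_le incI (leq_maxl m n) _ Ix.
  exact: chain_le incI (leq_maxr m n) _ Iy.
- by exists n => //; apply: ideal_Ml.
Qed.

(** The finitely many generators of the union already belong to one member of
    the chain. *)
Lemma noetherian_chain (I : nat -> set R) : noetherian ->
  (forall n, is_ideal (I n)) -> (forall n, I n `<=` I n.+1) ->
  exists N, \bigcup_n I n `<=` I N.
Proof.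
move=> noeR idI incI.
have [l lI Il] := noeR _ (bigcup_chain_ideal idI incI).
suff [N lN] : exists N, [set` l] `<=` I N.
  by exists N => x /Il; exact: ideal_gen_sub (idI N) lN x.
elim: l lI {Il} => [|a l IH] lI; first by exists 0%N => x.
have [|N lN] := IH; first by move=> x lx; apply: lI; rewrite /= inE [_ \in _]lx orbT.
have [|n _ Ia] := lI a; first by rewrite /= inE eqxx.
exists (maxn n N) => x /=; rewrite inE => /orP[/eqP-> | lx].
  exact: chain_le incI (leq_maxl n N) _ Ia.
exact: chain_le incI (leq_maxr n N) _ (lN x lx).
Qed.

(** If [T] failed for [I], it would fail for a strictly larger ideal, and so on
    along an infinite strictly increasing chain. *)
Lemma noetherian_ind (T : set R -> Prop) : noetherian ->
  (forall I, is_ideal I ->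
     (forall I', is_ideal I' -> I `<=` I' -> ~ (I' `<=` I) -> T I') -> T I) ->
  forall I, is_ideal I -> T I.
Proof.
move=> noeR step I idI; apply: contrapT => nTI.
pose bad I := is_ideal I /\ ~ T I.
have next (J : {J | bad J}) : {J' : {J | bad J} |
    sval J `<=` sval J' /\ ~ (sval J' `<=` sval J)}.
  apply: cid; case: J => J [idJ nTJ] /=; apply: contrapT => noJ'.
  apply: nTJ; apply: step => // J' idJ' JJ' J'J; apply: contrapT => nTJ'.
  by apply: noJ'; exists (exist _ J' (conj idJ' nTJ')).
pose seqJ n := iter n (fun J => sval (next J)) (exist bad I (conj idI nTI)).
have [|n|N subN] := @noetherian_chain (fun n => sval (seqJ n)) noeR.
- by move=> n; case: (svalP (seqJ n)).
- exact: (svalP (next (seqJ n))).1.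
apply: (svalP (next (seqJ N))).2 => x Jx.
by apply: subN; exists N.+1.
Qed.

End Noetherian.

Lemma field_noetherian (K : fieldType) : noetherian K.
Proof.
move=> I idI; have [[x [Ix x0]] | noI] := pselect (exists x, I x /\ x != 0).
  exists [:: 1] => y.
    by rewrite /= inE => /eqP->; rewrite -(mulVf x0); apply: ideal_Ml.
  move=> _; rewrite -(mulr1 y); have idG := ideal_genP [set` [:: 1 : K]].
  by apply: (ideal_Ml y idG); apply: sub_ideal_gen; rewrite /= inE.
exists [::] => [y //|y Iy]; suff -> : y = 0 by exact: ideal_0 (ideal_genP _).
by apply/eqP/negPn/negP => y0; apply: noI; exists y.
Qed.

Lemma noetherian_surj (A B : comNzRingType) (h : {rmorphism A -> B}) :
  (forall y, exists x, h x = y) -> noetherian A -> noetherian B.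
Proof.
move=> surj_h noeA I idI.
have [|l lI Il] := noeA [set x | I (h x)].
  split=> /= [|x y|a x]; rewrite ?rmorph0 ?rmorphD ?rmorphM.
  - exact: ideal_0.
  - exact: ideal_D.
  - exact: ideal_Ml.
exists (map h l) => [_ /mapP[x lx ->] | y]; first exact: lI.
have [x <-] := surj_h y; move=> /Il lx J [idJ lJ].
apply: (lx [set x | J (h x)]); split.
  split=> /= [|x1 y1|a x1]; rewrite ?rmorph0 ?rmorphD ?rmorphM.
  - exact: ideal_0.
  - exact: ideal_D.
  - exact: ideal_Ml.
by move=> z lz /=; apply: lJ; apply: map_f.
Qed.

(** Hilbert's basis theorem.  If an ideal [I] of [A[X]] were not finitely
    generated, one could pick successively [f_k] of least degree in
    [I] outside of [(f_0, .., f_(k-1))].  The ideal of [A] spanned by the leading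
    coefficients of the [f_k] is finitely generated, so some leading coefficient
    depends on the previous ones; since degrees do not decrease, [f_k] can then be
    replaced by an element of smaller degree. *)
Theorem hilbert_basis (A : comNzRingType) : noetherian A -> noetherian {poly A}.
Proof.
move=> noeA I idI; apply: contrapT => nfgI.
have least (l : seq {poly A}) : {f : {poly A} | [set` l] `<=` I ->
    [/\ I f, ~ ideal_gen [set` l] f & forall g, I g ->
        ~ ideal_gen [set` l] g -> (size f <= size g)%N]}.
  apply: cid; have [lI | nlI] := pselect ([set` l] `<=` I); last by exists 0.
  pose outside := [pred n | `[< exists f, [/\ I f, ~ ideal_gen [set` l] f & size f = n] >]].
  have [|n /asboolP[f [If lf <-]] min_n] := ex_minnP (P := outside).
    apply: contrapT => none; apply: nfgI; exists l => // f If.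
    apply: contrapT => lf; apply: none; exists (size f).
    by apply/asboolP; exists f.
  by exists f => _; split=> // g Ig lg; apply: min_n; apply/asboolP; exists g.
pose fs n := iter n (fun l => sval (least l) :: l) [::].
pose f n := sval (least (fs n)).
have fsI n : [set` fs n] `<=` I.
  elim: n => [|n IH] g; rewrite //= inE => /orP[/eqP-> | ]; last exact: IH.
  by case: (svalP (least (fs n)) IH).
have If n : I (f n) by case: (svalP (least (fs n)) (@fsI n)).
have nf n : ~ ideal_gen [set` fs n] (f n).
  by case: (svalP (least (fs n)) (@fsI n)).
have minf n g : I g -> ~ ideal_gen [set` fs n] g -> (size (f n) <= size g)%N.
  by case: (svalP (least (fs n)) (@fsI n)) => _ _; apply.
have sub_fs n : [set` fs n] `<=` [set` fs n.+1].
  by move=> g /= gn; rewrite inE [g \in _]gn orbT.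
have sub_gen n : ideal_gen [set` fs n] `<=` ideal_gen [set` fs n.+1].
  apply: ideal_gen_sub; first exact: ideal_genP.
  by apply: subset_trans (@sub_ideal_gen _ _); exact: sub_fs.
have size_f m n : (m <= n)%N -> (size (f m) <= size (f n))%N.
  move=> le_mn; apply: minf => // gf; apply: (nf n).
  exact: (chain_le (I := fun n => ideal_gen [set` fs n])) le_mn _ gf.
have size_fs n g : g \in fs n -> (size g <= size (f n))%N.
  elim: n g => [//|n IH] g; rewrite inE => /orP[/eqP->|/IH gn].
    exact: size_f (leqnSn n).
  exact: leq_trans gn (size_f _ _ (leqnSn n)).
pose lead n := ideal_gen [set` map lead_coef (fs n)].
have [|n|N subN] := noetherian_chain (I := lead) noeA.
- by move=> n; apply: ideal_genP.
- apply: ideal_gen_sub; first exact: ideal_genP.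
  by move=> a /= an; apply: sub_ideal_gen; rewrite /= inE [a \in _]an orbT.
have leadN : lead N (lead_coef (f N)).
  apply: subN; exists N.+1 => //; apply: sub_ideal_gen.
  by rewrite /= inE eqxx.
pose s := size (f N).
have f0 : f N != 0.
  by apply/eqP => f0; apply: (nf N); rewrite f0; exact: ideal_0 (ideal_genP _).
have s0 : (0 < s)%N by rewrite lt0n size_poly_eq0.
(* These coefficients form an ideal of A, and multiplying by a power of 'X
   shows that it contains the leading coefficients of all previous polynomials. *)
pose top : set A := [set a | exists g : {poly A},
  [/\ ideal_gen [set` fs N] g, (size g <= s)%N & g`_s.-1 = a]].
have [g [Gg sg gs]] : top (lead_coef (f N)).
  apply: leadN; split.
    have idG := ideal_genP [set` fs N]; split.
    - by exists 0; rewrite size_poly0 coef0; split=> //; exact: ideal_0 idG.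
    - move=> _ _ [g [Gg sg <-]] [h [Gh sh <-]]; exists (g + h); rewrite coefD.
      split=> //; first exact: (ideal_D idG).
      by rewrite (leq_trans (size_polyD _ _)) // geq_max sg.
    - move=> a _ [g [Gg sg <-]]; exists (a%:P * g); rewrite coefCM.
      split=> //; first exact: (ideal_Ml _ idG).
      by rewrite mul_polyC (leq_trans (size_scale_leq _ _)).
  move=> _ /mapP[g gN ->]; have sg : (size g <= s)%N := size_fs N g gN.
  exists (g * 'X^(s - size g)); split.
  - by apply: (ideal_Mr _ (ideal_genP _)); exact: sub_ideal_gen.
  - have [-> | g0] := eqVneq g 0; first by rewrite mul0r size_poly0.
    by rewrite size_mulXn // subnK.
  - have [-> | g0] := eqVneq g 0; first by rewrite mul0r coef0 lead_coef0.
    have sg0 : (0 < size g)%N by rewrite lt0n size_poly_eq0.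
    rewrite coefMXn /lead_coef.
    have -> : (s.-1 < s - size g)%N = false by move: (s) s0 sg sg0; lia.
    by congr (_`_ _); move: (s) s0 sg sg0; lia.
have ns : (size (f N - g)%R < s)%N.
  rewrite -(prednK s0) ltnS; apply/leq_sizeP => j le_sj; rewrite coefB.
  have [<- | ne] := eqVneq s.-1 j; first by rewrite gs subrr.
  have le_sj' : (s <= j)%N by rewrite -(prednK s0) ltn_neqAle ne.
  by rewrite (leq_sizeP _ _ (leqnn _)) // (leq_sizeP _ _ sg) // subrr.
have := minf N (f N - g); rewrite leqNgt ns => /(_ _ _)/negP; case=> //.
  apply: ideal_B => //; exact: ideal_gen_sub idI (@fsI N) g Gg.
by move=> Gfg; apply: (nf N); rewrite -(subrK g (f N)); apply: (ideal_D (ideal_genP _)).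
Qed.

(** Adjoining the indeterminates one at a time: for every [k] some noetherian
    ring maps onto the polynomials in the first [k] indeterminates. *)
Lemma mpoly_noetherian (K : fieldType) n : noetherian {mpoly K[n]}.
Proof.
suff onto k : (k <= n)%N -> exists2 A : comNzRingType, noetherian A &
    exists2 h : {rmorphism A -> {mpoly K[n]}}, (forall c, exists x, h x = c%:MP) &
      forall i : 'I_n, (i < k)%N -> exists x, h x = 'X_i.
  have [A noeA [h hC hX]] := onto n (leqnn n).
  apply: (noetherian_surj (h := h)) noeA.
  elim/mpolyind => [|c m p _ _ [y <-]]; first by exists 0; rewrite rmorph0.
  have [x1 x1E] := hC c.
  have [x2 x2E] : exists x, h x = 'X_[m].
    rewrite mpolyXE_id; apply: (big_ind (fun q => exists x, h x = q)).
    - by exists 1; rewrite rmorph1.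
    - by move=> _ _ [x <-] [z <-]; exists (x * z); rewrite rmorphM.
    - move=> i _; have [x <-] := hX i (ltn_ord i).
      by exists (x ^+ m i); rewrite rmorphXn.
  by exists (x1 * x2 + y); rewrite rmorphD rmorphM x1E x2E mul_mpolyC.
elim: k => [_ | k IH lt_kn].
  exists K; first exact: field_noetherian.
  exists (@mpolyC n K) => [c | i]; last by [].
  by exists c.
have [A noeA [h hC hX]] := IH (ltnW lt_kn).
exists {poly A}; first exact: hilbert_basis.
have com_h : commr_rmorph h 'X_(Ordinal lt_kn) by move=> a; apply: mulrC.
exists (horner_morph com_h) => [c | i].
  by have [x <-] := hC c; exists x%:P; rewrite /= horner_morphC.
rewrite ltnS leq_eqVlt => /orP[/eqP eq_ik | /hX[x <-]].
  exists 'X; rewrite /= horner_morphX; congr 'X_ _.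
  exact: val_inj.
by exists x%:P; rewrite /= horner_morphC.
Qed.

(** * Primary decomposition *)

Section LaskerNoether.
Variable R : comNzRingType.
Implicit Types (I J P Q : set R).

Definition primary_decomposition I n : Prop :=
  exists2 Q : 'I_n -> set R, I = \bigcap_(k in [set: 'I_n]) Q k &
    forall k, is_primary (Q k).

Lemma primary_decompositionI I J m n : primary_decomposition I m ->
  primary_decomposition J n -> primary_decomposition (I `&` J) (m + n).
Proof.
move=> [Q -> prQ] [Q' -> prQ'].
exists (fun k => match split k with inl i => Q i | inr j => Q' j end); last first.
  by move=> k; case: (split k).
apply/seteqP; split=> x.
  by move=> [Qx Q'x] k _; case: (split k) => i; [exact: Qx | exact: Q'x].
move=> QQ'x; split=> i _.
  by have := QQ'x (unsplit (inl i)) Logic.I; rewrite unsplitK.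
by have := QQ'x (unsplit (inr i)) Logic.I; rewrite unsplitK.
Qed.

(** Lasker's theorem.  When [I] is not primary because of [x * y], the powers of
    [y] have a largest colon ideal [(I : y ^+ N)], and then [I] is the
    intersection of the two larger ideals [I + (x)] and [I + (y ^+ N)]. *)
Lemma lasker I : noetherian R -> is_ideal I -> exists n, primary_decomposition I n.
Proof.
move=> noeR; move: I; apply: (noetherian_ind noeR) => I idI IH.
have [I1 | nI1] := pselect (I 1).
  exists 0%N, (fun _ => I); last by case.
  apply/seteqP; split=> x; first by move=> _ [].
  by move=> _; rewrite -(mulr1 x); apply: ideal_Ml.
have [prI | nprI] := pselect (is_primary I).
  exists 1%N, (fun _ => I) => //; apply/seteqP; split=> x; first by move=> Ix k _.
  by move=> Ix; exact: (Ix ord0).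
have [x [y [Ixy nIx nIy]]] : exists x y, [/\ I (x * y), ~ I x & ~ radical I y].
  apply: contrapT => none; apply: nprI; split=> // x y Ixy.
  have [Ix|nIx] := pselect (I x); first by left.
  have [Iy|nIy] := pselect (radical I y); first by right.
  by case: none; exists x, y.
have [|n|N subN] := noetherian_chain (I := fun n => colon I (y ^+ n)) noeR.
- by move=> n; apply: colonP.
- by move=> a; rewrite /colon /= exprS -mulrA; apply: ideal_Ml.
pose Ix := ideal_add I (principal x); pose Iy := ideal_add I (principal (y ^+ N)).
have [idx idy] : is_ideal Ix /\ is_ideal Iy.
  by split; apply: ideal_addP => //; apply: principalP.
have [||m Dx] := IH Ix idx.
- by apply: ideal_addl; apply: principalP.
- move=> subI; apply: nIx; apply: subI.
  by apply: ideal_addr => //; exact: principal_id.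
have [||n Dy] := IH Iy idy.
- by apply: ideal_addl; apply: principalP.
- move=> subI; apply: nIy; exists N; apply: subI.
  by apply: ideal_addr => //; exact: principal_id.
exists (m + n)%N; suff -> : I = Ix `&` Iy by apply: primary_decompositionI.
apply/seteqP; split=> [z Iz | z].
  by split; apply: ideal_addl => //; apply: principalP.
case=> -[i [_ [Ii [b ->] zE]]] [j [_ [Ij [a ->] zE']]].
(* Multiplying [z] by [y] kills the multiples of [x] modulo [I], which puts
   [a] in the colon ideal of [y ^+ N.+1]. *)
have Iya : I (y ^+ N * a).
  apply: subN; exists N.+1 => //; rewrite /colon /=.
  have -> : y ^+ N.+1 * a = i * y + b * (x * y) - j * y.
    have <- : (i + b * x) * y - j * y = i * y + b * (x * y) - j * y by ring.
    by rewrite -zE zE' exprS; ring.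
  apply: (ideal_B idI); last exact: (ideal_Mr _ idI Ij).
  by apply: (ideal_D idI); [exact: (ideal_Mr _ idI) | exact: (ideal_Ml _ idI)].
by rewrite zE'; apply: (ideal_D idI) => //; rewrite mulrC.
Qed.

Lemma bigcap_lift n (Q : 'I_n.+1 -> set R) k :
  \bigcap_(j in [set~ k]) Q j = \bigcap_(j in [set: 'I_n]) Q (lift k j).
Proof.
apply/seteqP; split=> x Qx j.
  by move=> _; apply: Qx => /= e; move/eqP: (neq_lift k j); rewrite e.
by case: (unliftP k j) => [j' -> _ | -> /(_ erefl)//]; apply: Qx.
Qed.

Lemma bigcapD1 (T : Type) (Q : T -> set R) k :
  \bigcap_(j in [set: T]) Q j = Q k `&` \bigcap_(j in [set~ k]) Q j.
Proof.
apply/seteqP; split=> x Qx; first by split=> [|j _]; apply: Qx.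
move=> j _; have [->|ne] := pselect (j = k); first by case: Qx.
by case: Qx => _; apply.
Qed.

(** A primary decomposition with the least number of components is minimal: two
    components with the same radical could be replaced by their intersection, and
    a superfluous one could be omitted. *)
Lemma minimal_primary_decomposition_exists I : noetherian R -> is_ideal I ->
  exists n (Q : 'I_n -> set R), minimal_primary_decomposition I Q.
Proof.
move=> noeR idI.
have exD : exists n, `[< primary_decomposition I n >].
  by have [n D] := lasker noeR idI; exists n; apply/asboolP.
case: (ex_minnP exD) => n /asboolP[Q IE prQ] min_n {exD}.
exists n, Q; split=> //.
- move=> j k rjk; apply: contrapT => /eqP ne_jk.
  case: n => [|n] in Q IE prQ min_n j k rjk ne_jk *; first by case: j ne_jk {rjk}.
  suff /asboolP/min_n : primary_decomposition I n by rewrite ltnn.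
  have [k' kE | jk] := unliftP j k; last by rewrite jk eqxx in ne_jk.
  exists (fun l => if l == k' then Q j `&` Q k else Q (lift j l)).
    rewrite IE (bigcapD1 _ j) bigcap_lift; apply/seteqP; split=> x.
      case=> Qj Ql l _; case: eqP => [_ | _]; last exact: Ql.
      by split=> //; rewrite kE; apply: Ql.
    move=> Qx; split; first by have := Qx k' Logic.I; rewrite eqxx => -[].
    move=> l _; have := Qx l Logic.I; case: eqP => [-> | //].
    by rewrite -kE => -[].
  move=> l; case: eqP => _ //; exact: primaryI.
- move=> k sub_k.
  case: n => [|n] in Q IE prQ min_n k sub_k *; first by case: k {sub_k}.
  suff /asboolP/min_n : primary_decomposition I n by rewrite ltnn.
  exists (fun l => Q (lift k l)) => //.
  rewrite IE (bigcapD1 _ k) -bigcap_lift; apply/seteqP.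
  by split=> [x [] | x Qx] //; split=> //; apply: sub_k.
Qed.

(** The component of [I] at a minimal prime [P] lies in every ideal [Q] containing
    [I] modulo which the elements outside of [P] are regular: the components at
    the other primes have elements outside of [P], and the product of such
    elements brings the component at [P] into [I]. *)
Lemma minimal_component_sub I P Q : noetherian R -> is_ideal I ->
  minimal_prime I P -> I `<=` Q -> (forall x y, ~ P y -> Q (x * y) -> Q x) ->
  exists2 C, minimal_component I C & C `<=` Q.
Proof.
move=> noeR idI [prP IP minP] IQ regQ.
have [n [F decF]] := minimal_primary_decomposition_exists noeR idI.
have [IE prF injF _] := decF.
have radE k : F k `<=` P -> radical (F k) = P.
  move=> FP; apply: minP; [exact: radical_primary | | exact: radical_sub_prime].
  by apply: subset_trans (@radical_sub _ _); rewrite IE => x; apply.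
have out k : ~ F k `<=` P -> exists y, F k y /\ ~ P y.
  move=> nFP; apply: contrapT => none; apply: nFP => y Fy.
  by apply: contrapT => nPy; apply: none; exists y.
have outside (p : pred 'I_n) : (forall k, p k -> ~ F k `<=` P) ->
    exists2 y, ~ P y & forall k, p k -> F k y.
  move=> nFP.
  have /choice[y yP] : forall k, exists y, p k -> F k y /\ ~ P y.
    move=> k; have [pk | npk] := boolP (p k); last by exists 0.
    by have [y yP] := out k (nFP k pk); exists y.
  exists (\prod_(k | p k) y k); first by apply: prime_nprod => // k /yP[].
  move=> k pk; rewrite (bigD1 k) //=; apply: ideal_Mr; first exact: primary_ideal.
  by case: (yP k pk).
have [k FkP] : exists k, F k `<=` P.
  apply: contrapT => none.
  have [|y nPy Fy] := outside predT; first by move=> k _ FkP; apply: none; exists k.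
  by apply: nPy; apply: IP; rewrite IE => k _; apply: Fy.
have [|y nPy Fy] := outside (predC1 k).
  by move=> j /= /eqP ne_jk FjP; apply: ne_jk; apply: injF; rewrite !radE.
exists (F k); first by exists n, F, k; split=> //; rewrite radE.
move=> x Fx; apply: (regQ x y) => //; apply: IQ; rewrite IE => j _.
have [-> | ne_jk] := eqVneq j k; first by apply: ideal_Mr => //; apply: primary_ideal.
by apply: ideal_Ml; [exact: primary_ideal | exact: Fy].
Qed.

Lemma minimal_componentP I C : minimal_component I C ->
  [/\ is_primary C, I `<=` C & minimal_prime I (radical C)].
Proof.
move=> [n [Q [k [[IE prQ _ _] minP ->]]]]; split=> //.
by rewrite IE => x; apply.
Qed.

End LaskerNoether.

(** * Substitutions and divisibility *)

(** This serves to identify kernels: when [F] is the identity and [I] contains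
    every ['X_i - G 'X_i], each polynomial in the kernel of [G] is in [I]. *)
Lemma mpoly_rmorph_congr (K : fieldType) n (S : comNzRingType)
    (F G : {rmorphism {mpoly K[n]} -> S}) (I : set S) :
  is_ideal I -> (forall c, F c%:MP = G c%:MP) ->
  (forall i, I (F 'X_i - G 'X_i)) -> forall p, I (F p - G p).
Proof.
move=> idI FGC FGX; have IM x x' y y' : I (x - x') -> I (y - y') -> I (x * y - x' * y').
  move=> Ix Iy; have -> : x * y - x' * y' = y * (x - x') + x' * (y - y') by ring.
  by apply: (ideal_D idI); apply: (ideal_Ml _ idI).
elim/mpolyind => [|c m p _ _ IH]; first by rewrite !rmorph0 subrr; apply: ideal_0.
rewrite -mul_mpolyC !rmorphD !rmorphM FGC opprD addrACA.
apply: (ideal_D idI) => //; apply: (IM); first by rewrite subrr; apply: ideal_0.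
rewrite mpolyXE_id !rmorph_prod /=.
apply: (big_ind2 (fun x y => I (x - y))) => //; first by rewrite subrr; apply: ideal_0.
by move=> i _; rewrite !rmorphXn; apply: ideal_subrX.
Qed.

(** The powers of a principal prime ideal are primary. *)
Lemma principalX_regular (D : idomainType) (p x y : D) n :
  is_prime (principal p) -> ~ principal p y ->
  principal (p ^+ n) (x * y) -> principal (p ^+ n) x.
Proof.
move=> [_ _ prp] npy; elim: n x => [|n IH] x.
  by move=> _; exists x; rewrite mulr1.
move=> [a xyE]; have [b xE] : principal p x.
  have [|//|//] := prp x y; by exists (a * p ^+ n); rewrite xyE exprSr mulrA.
have [p0 | p0] := eqVneq p 0; first by exists 0; rewrite xE p0 mulr0 mul0r.
have [|c bE] := IH b.
  exists a; apply: (mulIf p0); rewrite -mulrA [y * p]mulrC mulrA -xE xyE exprSr.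
  by rewrite mulrA.
by exists c; rewrite xE bE exprSr mulrA.
Qed.

Lemma principal_prime (D E : idomainType) (h : {rmorphism D -> E}) p :
  h p = 0 -> (forall x, h x = 0 -> principal p x) -> is_prime (principal p).
Proof.
move=> hp kerh; split; first exact: principalP.
- by case=> a /(congr1 h)/eqP; rewrite rmorph1 rmorphM hp mulr0 oner_eq0.
- move=> x y [a /(congr1 h)/eqP]; rewrite !rmorphM hp mulr0 mulf_eq0.
  by case/orP => /eqP/kerh; [left | right].
Qed.

(** Pairwise non-associated prime elements are handled one at a time: [p t ^+ n]
    divides the quotient of [x] by the product over the remaining indices, because
    [p t] does not divide that product. *)
Lemma principal_prod (D : idomainType) (T : eqType) (p : T -> D) n (r : seq T) x :
  uniq r -> {in r, forall t, is_prime (principal (p t))} ->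
  {in r &, forall t t', t != t' -> ~ principal (p t) (p t')} ->
  {in r, forall t, principal (p t ^+ n) x} -> principal (\prod_(t <- r) p t ^+ n) x.
Proof.
elim: r => [|t r IH] /=; first by move=> *; exists x; rewrite big_nil mulr1.
move=> /andP[tr uniq_r] prp cop px.
have tt : t \in t :: r by rewrite inE eqxx.
have rr t' : t' \in r -> t' \in t :: r by rewrite inE orbC => ->.
have [|||a xE] := IH uniq_r.
- by move=> t' /rr; apply: prp.
- by move=> t1 t2 /rr + /rr; apply: cop.
- by move=> t' /rr; apply: px.
have [e aE] : principal (p t ^+ n) a.
  apply: (@principalX_regular D (p t) a (\prod_(t <- r) p t ^+ n) n (prp t tt)).
    rewrite big_seq; apply: prime_nprod; first exact: prp.
    move=> t' t'r /(primeX (prp t tt)); apply: cop => //; first exact: rr.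
    by apply: contraNneq tr => ->.
  by rewrite -xE; apply: px.
by exists e; rewrite big_cons xE aE mulrA.
Qed.

Section Preimage.
Variables (R : comNzRingType) (D : idomainType) (phi : {rmorphism R -> D}).

(** With [p] a prime element, these are the primes and, with a power of [p],
    the primary ideals to which the components of an ideal are compared. *)
Definition preim_principal (p : D) : set R := [set x | principal p (phi x)].

Lemma preim_principalP p : is_ideal (preim_principal p).
Proof.
have idp := principalP p; rewrite /preim_principal; split=> /= [|x y|a x].
- by rewrite rmorph0; apply: ideal_0.
- by rewrite rmorphD; apply: ideal_D.
- by rewrite rmorphM; apply: ideal_Ml.
Qed.

Lemma preim_principal_prime p :
  is_prime (principal p) -> is_prime (preim_principal p).
Proof.
move=> [_ p1 prp]; split; first exact: preim_principalP.
- by rewrite /preim_principal /= rmorph1.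
- by move=> x y; rewrite /preim_principal /= rmorphM; apply: prp.
Qed.

Lemma preim_principalX_sub p n :
  (0 < n)%N -> preim_principal (p ^+ n) `<=` preim_principal p.
Proof.
by move=> n0 x [a xE]; exists (a * p ^+ n.-1); rewrite xE -mulrA -exprSr prednK.
Qed.

Lemma preim_principalX_regular p n x y :
  is_prime (principal p) -> ~ preim_principal p y ->
  preim_principal (p ^+ n) (x * y) -> preim_principal (p ^+ n) x.
Proof. by rewrite /preim_principal /= rmorphM; apply: principalX_regular. Qed.

Lemma preim_minimal_prime J p n : is_prime (principal p) -> (0 < n)%N ->
  J `<=` preim_principal (p ^+ n) ->
  (forall P, is_prime P -> J `<=` P -> P `<=` preim_principal p ->
     preim_principal p `<=` P) ->
  minimal_prime J (preim_principal p).
Proof.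
move=> prp n0 JQ minP; split; first exact: preim_principal_prime.
  exact: subset_trans (preim_principalX_sub n0).
by move=> P prP JP Pp; apply/seteqP; split=> //; apply: minP.
Qed.

Lemma minimal_component_sub_preim J p n : noetherian R -> is_ideal J ->
  (0 < n)%N -> is_prime (principal p) -> J `<=` preim_principal (p ^+ n) ->
  minimal_prime J (preim_principal p) ->
  exists2 C, minimal_component J C & C `<=` preim_principal (p ^+ n).
Proof.
move=> noeR idJ n0 prp JQ minp; apply: minimal_component_sub minp JQ _ => //.
by move=> x y; apply: preim_principalX_regular.
Qed.

End Preimage.

(** * Toric substitutions *)

(** A substitution of monomials for the indeterminates sends monomials to
    monomials, so the coefficients of [p] are regrouped according to the images of
    the monomials: modulo [I] each group collapses to one monomial, whose
    coefficient is the one of the image of [p]. *)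
Lemma monomial_subst_ideal (K : fieldType) n (e : 'I_n -> 'X_{1..n})
    (I : set {mpoly K[n]}) (S : 'X_{1..n} -> Prop) (p : {mpoly K[n]})
    (image := fun m : 'X_{1..n} => (\sum_(i < n) e i *+ m i)%MM) :
  is_ideal I ->
  (forall m m', image m = image m' -> I ('X_[m] - 'X_[m'])) ->
  (forall m, S (image m) -> I 'X_[m]) ->
  (forall k, k \in msupp (mmap (@mpolyC n K) (fun i => 'X_[e i]) p) -> S k) ->
  I p.
Proof.
move=> idI fibres IS Sp.
have imageX m : mmap1 (fun i => 'X_[e i]) m = 'X_[image m] :> {mpoly K[n]}.
  by rewrite /mmap1 mprodXnE.
pose rep k : {mpoly K[n]} :=
  if pselect (exists m, image m = k) is left im then 'X_[sval (cid im)] else 0.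
have Irep m : I ('X_[m] - rep (image m)).
  rewrite /rep; case: pselect => [im|[]]; last by exists m.
  by apply: fibres; rewrite (svalP (cid im)).
set q := mmap _ _ p in Sp; pose ks := undup [seq image m | m <- msupp p].
have qE k : q@_k = \sum_(m <- msupp p) p@_m * (image m == k)%:R.
  rewrite /q /mmap raddf_sum /=; apply: eq_bigr => m _.
  by rewrite imageX mul_mpolyC mcoeffZ mcoeffX.
have repE : \sum_(m <- msupp p) p@_m *: rep (image m) = \sum_(k <- ks) q@_k *: rep k.
  transitivity (\sum_(m <- msupp p) \sum_(k <- ks)
                  (p@_m * (image m == k)%:R) *: rep k).
    apply: eq_big_seq => m mp; rewrite (bigD1_seq (image m)) ?undup_uniq //=; last first.
      by rewrite mem_undup map_f.
    rewrite eqxx mulr1 big1 ?addr0 // => k; rewrite eq_sym => /negPf ->.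
    by rewrite mulr0 scale0r.
  rewrite exchange_big /=; apply: eq_bigr => k _.
  by rewrite qE scaler_suml.
rewrite [p]mpolyE; apply: (ideal_congr (y := \sum_(m <- msupp p) p@_m *: rep (image m)) idI).
  rewrite -sumrB; apply: (ideal_sum _ idI) => m _.
  by rewrite -scalerBr -mul_mpolyC; apply: (ideal_Ml _ idI).
rewrite repE big_seq; apply: (ideal_sum _ idI) => k; rewrite mem_undup => /mapP[m _ ->].
have [qm | nqm] := boolP (image m \in msupp q); last first.
  by rewrite (memN_msupp_eq0 nqm) scale0r; apply: ideal_0.
rewrite -mul_mpolyC; apply: (ideal_Ml _ idI).
have -> : rep (image m) = 'X_[m] - ('X_[m] - rep (image m)) by rewrite opprB addrC subrK.
by apply: (ideal_B idI) => //; apply: IS; apply: Sp.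
Qed.

(** * Differences of powers *)

Lemma irreducible_factor (K : fieldType) (q : {poly K}) : (1 < size q)%N ->
  exists2 r, irreducible_poly r & r %| q.
Proof.
move=> q1.
have : exists n, `[< exists r : {poly K}, [/\ (1 < size r)%N, r %| q & size r = n] >].
  by exists (size q); apply/asboolP; exists q; rewrite dvdpp.
case/ex_minnP => n /asboolP[r [r1 rq <-]] min_r; exists r => //.
split=> // t t1 tr; rewrite -dvdp_size_eqp // eqn_leq (dvdp_leq _ tr); last first.
  by rewrite -size_poly_gt0 ltnW.
apply: min_r; apply/asboolP; exists t; split=> //; last exact: dvdp_trans rq.
have t0 : t != 0 by apply: contraTneq tr => ->; rewrite dvd0p -size_poly_gt0 ltnW.
by rewrite ltn_neqAle eq_sym t1 size_poly_gt0.
Qed.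

(** An irreducible factor has a root in some finite extension, and a root of
    ['X^n - 1] there already lies in [K]. *)
Lemma unity_split (K : fieldType) n : (0 < n)%N -> contains_roots_of_unity K n ->
  exists zs : seq K, 'X^n - 1 = \prod_(z <- zs) ('X - z%:P) :> {poly K}.
Proof.
move=> n0 rootsK.
suff split m (q : {poly K}) : (size q <= m.+1)%N -> q %| 'X^n - 1 ->
    exists zs : seq K, q %= \prod_(z <- zs) ('X - z%:P).
  have [zs qzs] := split _ _ (leqnSn _) (dvdpp _).
  exists zs; apply/eqP; rewrite -eqp_monic ?monic_prod_XsubC //.
  by rewrite monicXnsubC.
have p0 : 'X^n - 1 != 0 :> {poly K} by rewrite monic_neq0 ?monicXnsubC.
elim: m q => [|m IH] q qm qdvd; have [q1|q1] := leqP (size q) 1.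
- exists [::]; rewrite big_nil -size_poly_eq1 eqn_leq q1 size_poly_gt0.
  exact: dvdpN0 qdvd p0.
- by have := leq_trans q1 qm.
- exists [::]; rewrite big_nil -size_poly_eq1 eqn_leq q1 size_poly_gt0.
  exact: dvdpN0 qdvd p0.
have [r irr_r rq] := irreducible_factor q1.
have [L _ [z rz _]] := irredp_FAdjoin irr_r.
have zn : z ^+ n = 1.
  have : root (map_poly (in_alg L) ('X^n - 1)) z.
    by apply: root_dvdp rz; rewrite dvdp_map (dvdp_trans rq).
  by rewrite rmorphB rmorph1 /= map_polyXn rootE !hornerE subr_eq0 => /eqP.
have [y yz] := rootsK L (in_alg L) z zn.
have qy : root q y by apply: root_dvdp rq _; rewrite -(fmorph_root (in_alg L)) yz.
have := qy; rewrite -dvdp_XsubCl => /dvdpP[q' qE].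
have q0 : q != 0 by apply: contraTneq q1 => ->; rewrite size_poly0.
have q'0 : q' != 0 by apply: contraNneq q0 => q'0; rewrite qE q'0 mul0r.
have [||zs q'zs] := IH q'.
- by move: qm; rewrite qE size_Mmonic ?monicXsubC // size_XsubC addn2.
- by apply: dvdp_trans qdvd; rewrite qE dvdp_mulr.
by exists (y :: zs); rewrite big_cons mulrC qE eqp_mul2r ?polyXsubC_eq0.
Qed.

(** Homogenising the splitting of ['X^n - 1], which takes place in the field of
    fractions, where [x / y] can be substituted for ['X]. *)
Lemma subrXX_split (K : fieldType) (D : idomainType) (h : {rmorphism K -> D})
    (zs : seq K) n (x y : D) :
  'X^n - 1 = \prod_(z <- zs) ('X - z%:P) :> {poly K} -> y != 0 ->
  x ^+ n - y ^+ n = \prod_(z <- zs) (x - h z * y).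
Proof.
move=> split y0; pose F := @FracField.tofrac D.
have y0F : F y != 0 by rewrite tofrac_eq0.
apply/eqP; rewrite -tofrac_eq rmorphB !rmorphXn rmorph_prod /=; apply/eqP.
have sz : size zs = n.
  have /(congr1 (fun p : {poly K} => size p)) := split.
  rewrite size_prod_XsubC; have [->|n0] := posnP n.
    by rewrite expr0 subrr size_poly0.
  by rewrite size_XnsubC // => -[].
have := congr1 (fun p => (map_poly (@FracField.tofrac D \o h) p).[F x / F y]) split.
rewrite rmorphB rmorph1 /= map_polyXn rmorph_prod horner_prod !hornerE /=.
move=> /(congr1 (fun t => t * F y ^+ n)).
rewrite mulrBl mul1r expr_div_n divfK ?expf_neq0 // => ->.
have -> : F y ^+ n = \prod_(z <- zs) F y.
  by rewrite big_const_seq count_predT sz iter_mulr_1.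
rewrite -big_split /=; apply: eq_bigr => z _.
rewrite map_polyXsubC !hornerE /= mulrBl divfK //.
by rewrite rmorphB rmorphM.
Qed.

(** With [d = d' * i] and [i] a power of the characteristic exponent, taking
    [i]-th powers is additive, and the [d']-th roots of unity are distinct. *)
Lemma subrXX_factor (K : fieldType) (D : idomainType) (h : {rmorphism K -> D})
    (d d' i : nat) : (0 < d)%N -> d = (d' * i)%N ->
  (forall p : nat, p \in [pchar K] ->
     (exists e : nat, i = (p ^ e)%N) /\ coprime d' p) ->
  ([pchar K] =i pred0 -> d' = d /\ i = 1%N) ->
  contains_roots_of_unity K (d %/ i) ->
  exists2 zs : seq K, uniq zs & forall x y : D, y != 0 ->
    x ^+ d - y ^+ d = \prod_(z <- zs) (x - h z * y) ^+ i.
Proof.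
move=> d0 dE charp char0 rootsK.
have /andP[d'0 i0] : (0 < d')%N && (0 < i)%N by rewrite -muln_gt0 -dE.
rewrite dE mulnK // in rootsK.
have [zs zsE] := unity_split d'0 rootsK.
have [nzd' powD] : d'%:R != 0 :> K /\ forall x y : D, x ^+ i - y ^+ i = (x - y) ^+ i.
  have [[p pK] | noK] := pselect (exists p, p \in [pchar K]).
    have [[e iE] cop] := charp p pK; have p_pr : prime p by case/andP: pK.
    split; first by rewrite -(dvdn_pcharf pK) -prime_coprime // coprime_sym.
    move=> x y; rewrite -{1}(subrK y x) exprDn_pchar ?addrK //.
    rewrite iE pnatX; apply/orP; left; rewrite (pnatE _ p_pr).
    exact: (rmorph_pchar h).
  have K0 : [pchar K] =i pred0.
    by move=> p; apply/negbTE/negP => pK; apply: noK; exists p.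
  have [_ ->] := char0 K0; split=> [|x y]; last by rewrite !expr1.
  by rewrite (pcharf0P K).1 // -lt0n.
exists zs; first by rewrite -separable_prod_XsubC -zsE separable_Xn_sub_1.
move=> x y y0; rewrite dE !exprM powD prodrXl; congr (_ ^+ _).
exact: subrXX_split.
Qed.

(** * The first Mayr-Meyer ideal *)

Section MayrMeyer.
Variables (K : fieldType) (d : nat).
Hypothesis d_gt0 : (0 < d)%N.
Local Notation R := {mpoly K[12]}.
Local Notation s := (vs K).
Local Notation f := (vf K).
Local Notation s1 := (vs1 K).
Local Notation f1 := (vf1 K).
Local Notation c := (vc K).
Local Notation b := (vb K).
Local Notation J := (mayr_meyer1 K d).
Implicit Types (I P : set R) (l : seq R) (pt : seq K).

(** The [i]-th entry of [l] replaces the [i]-th indeterminate, in the order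
    s, f, s1, f1, c1, .., c4, b1, .., b4; likewise for the points [pt] below. *)
Definition subst (l : seq R) : R -> R := mmap (@mpolyC 12 K) (fun i : 'I_12 => l`_i).
HB.instance Definition _ l := GRing.RMorphism.copy (subst l)
  (mmap (@mpolyC 12 K) (fun i : 'I_12 => l`_i)).

Lemma substX l k : (k < 12)%N -> subst l 'X_(inord k) = l`_k.
Proof. by move=> k12; rewrite /subst mmapX mmap1U inordK. Qed.

Lemma substE l :
  ((subst l s = l`_0) * (subst l f = l`_1) * (subst l s1 = l`_2) * (subst l f1 = l`_3)) *
  ((subst l (c 1) = l`_4) * (subst l (c 2) = l`_5) *
   (subst l (c 3) = l`_6) * (subst l (c 4) = l`_7)) *
  ((subst l (b 1) = l`_8) * (subst l (b 2) = l`_9) *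
   (subst l (b 3) = l`_10) * (subst l (b 4) = l`_11)).
Proof. by rewrite !substX. Qed.

Lemma substC l a : subst l a%:MP = a%:MP.
Proof. exact: mmapC. Qed.

Definition eval pt : R -> K := meval (fun i : 'I_12 => pt`_i).
HB.instance Definition _ pt := GRing.RMorphism.copy (eval pt)
  (meval (fun i : 'I_12 => pt`_i)).

Lemma evalX pt k : (k < 12)%N -> eval pt 'X_(inord k) = pt`_k.
Proof. by move=> k12; rewrite /eval mevalXU inordK. Qed.

Lemma evalE pt :
  ((eval pt s = pt`_0) * (eval pt f = pt`_1) * (eval pt s1 = pt`_2) * (eval pt f1 = pt`_3)) *
  ((eval pt (c 1) = pt`_4) * (eval pt (c 2) = pt`_5) *
   (eval pt (c 3) = pt`_6) * (eval pt (c 4) = pt`_7)) *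
  ((eval pt (b 1) = pt`_8) * (eval pt (b 2) = pt`_9) *
   (eval pt (b 3) = pt`_10) * (eval pt (b 4) = pt`_11)).
Proof. by rewrite !evalX. Qed.

Lemma evalC pt a : eval pt a%:MP = a.
Proof. exact: mevalC. Qed.

Lemma mayr_meyer1_ideal : is_ideal J.
Proof. exact: ideal_genP. Qed.

Lemma mayr_meyer1_sub I : is_ideal I ->
    I (s1 - s * c 1) -> I (f1 - s * c 4) ->
    I (c 1 * (s - f * b 1 ^+ d)) -> I (c 2 * (s - f * b 2 ^+ d)) ->
    I (c 3 * (s - f * b 3 ^+ d)) -> I (c 4 * (s - f * b 4 ^+ d)) ->
    I (f * c 1 - s * c 2) -> I (f * c 4 - s * c 3) -> I (s * (c 3 - c 2)) ->
    I (f * (c 2 * b 1 - c 3 * b 4)) -> I (f * c 2 * (b 2 - b 3)) ->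
  J `<=` I.
Proof.
move=> idI h1 h2 h3 h4 h5 h6 h7 h8 h9 h10 h11; apply: ideal_gen_sub => // x /=.
rewrite !inE.
by do 10? [case/orP => [/eqP-> // | ]]; move/eqP->.
Qed.

Lemma mayr_meyer1_gens I : J `<=` I ->
  [/\ I (s1 - s * c 1), I (f1 - s * c 4),
    [/\ I (c 1 * (s - f * b 1 ^+ d)), I (c 2 * (s - f * b 2 ^+ d)),
        I (c 3 * (s - f * b 3 ^+ d)) & I (c 4 * (s - f * b 4 ^+ d))],
    [/\ I (f * c 1 - s * c 2), I (f * c 4 - s * c 3) & I (s * (c 3 - c 2))] &
    I (f * (c 2 * b 1 - c 3 * b 4)) /\ I (f * c 2 * (b 2 - b 3))].
Proof.
move=> JI; pose gens := [:: s1 - s * c 1; f1 - s * c 4]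
  ++ [seq c j * (s - f * b j ^+ d) | j <- [:: 1; 2; 3; 4]%N]
  ++ [:: f * c 1 - s * c 2; f * c 4 - s * c 3; s * (c 3 - c 2);
         f * (c 2 * b 1 - c 3 * b 4); f * c 2 * (b 2 - b 3)].
have gensI k : (k < 11)%N -> I gens`_k.
  by move=> k11; apply: JI; apply: sub_ideal_gen; apply: mem_nth.
split; [exact: (gensI 0) | exact: (gensI 1) | split | split | split].
- exact: (gensI 2).
- exact: (gensI 3).
- exact: (gensI 4).
- exact: (gensI 5).
- exact: (gensI 6).
- exact: (gensI 7).
- exact: (gensI 8).
- exact: (gensI 9).
- exact: (gensI 10).
Qed.

(** ** Colon ideals *)

(** Each of the next four lemmas lists elements that are multiplied into [I] by
    [s], [f], [f * c 3], [f * c 2] or [s * c 2].  The identities behind them are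
    [s * c j = f * c j * b j ^+ d], [f * c 1 = s * c 2 = s * c 3 = f * c 4],
    [f * c 2 * b 1 = f * c 3 * b 4] and [f * c 2 * b 2 = f * c 2 * b 3]
    modulo [J]. *)
Section Relations.
Variable I : set R.
Hypotheses (idI : is_ideal I) (JI : J `<=` I).

Lemma colon_sf : I (f * c 2) -> I (f * c 3) ->
  [/\ [/\ I (s * c 1), I (s * c 2), I (s * c 3) & I (s * c 4)],
      [/\ I (f * c 1) & I (f * c 4)] &
      [/\ I (s * s1), I (s * f1), I (f * s1) & I (f * f1)]].
Proof.
have [gs1 gf1 [gc1 gc2 gc3 gc4] [k1 k2 k3] _] := mayr_meyer1_gens JI.
move=> fc2 fc3.
have sc2 : I (s * c 2) by apply: (ideal_comb2 (a1 := 1) (a2 := b 2 ^+ d) idI gc2 fc2); ring.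
have sc3 : I (s * c 3) by apply: (ideal_comb2 (a1 := 1) (a2 := b 3 ^+ d) idI gc3 fc3); ring.
have fc1 : I (f * c 1) by apply: (ideal_comb2 (a1 := 1) (a2 := 1) idI k1 sc2); ring.
have fc4 : I (f * c 4) by apply: (ideal_comb2 (a1 := 1) (a2 := 1) idI k2 sc3); ring.
have sc1 : I (s * c 1) by apply: (ideal_comb2 (a1 := 1) (a2 := b 1 ^+ d) idI gc1 fc1); ring.
have sc4 : I (s * c 4) by apply: (ideal_comb2 (a1 := 1) (a2 := b 4 ^+ d) idI gc4 fc4); ring.
split; [by split | by split | split].
- by apply: (ideal_comb2 (a1 := s) (a2 := s) idI gs1 sc1); ring.
- by apply: (ideal_comb2 (a1 := s) (a2 := s) idI gf1 sc4); ring.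
- by apply: (ideal_comb2 (a1 := f) (a2 := s) idI gs1 fc1); ring.
- by apply: (ideal_comb2 (a1 := f) (a2 := s) idI gf1 fc4); ring.
Qed.

Lemma colon_fc3 : I (f * c 2) ->
  [/\ I (f * c 3 * s), I (f * c 3 * s1), I (f * c 3 * f1),
     [/\ I (f * c 3 * c 1), I (f * c 3 * c 2) & I (f * c 3 * c 4)] &
     I (f * c 3 * b 4) /\ I (f * c 3 * b 3 ^+ d)].
Proof.
have [gs1 gf1 [_ gc2 gc3 _] [k1 k2 k3] [k4 _]] := mayr_meyer1_gens JI.
move=> fc2.
have sc2 : I (s * c 2) by apply: (ideal_comb2 (a1 := 1) (a2 := b 2 ^+ d) idI gc2 fc2); ring.
have sc3 : I (s * c 3) by apply: (ideal_comb2 (a1 := 1) (a2 := 1) idI k3 sc2); ring.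
split; [| | | split | split].
- by apply: (ideal_comb1 (a := f) idI sc3); ring.
- by apply: (ideal_comb2 (a1 := f * c 3) (a2 := f * c 1) idI gs1 sc3); ring.
- by apply: (ideal_comb2 (a1 := f * c 3) (a2 := f * c 4) idI gf1 sc3); ring.
- by apply: (ideal_comb2 (a1 := c 3) (a2 := c 3) idI k1 sc2); ring.
- by apply: (ideal_comb1 (a := c 3) idI fc2); ring.
- by apply: (ideal_comb2 (a1 := c 3) (a2 := c 3) idI k2 sc3); ring.
- by apply: (ideal_comb2 (a1 := - 1) (a2 := b 1) idI k4 fc2); ring.
- by apply: (ideal_comb2 (a1 := - 1) (a2 := 1) idI gc3 sc3); ring.
Qed.

Lemma colon_fc2 : I (s * c 2) ->
  [/\ I (f * c 2 * s), I (f * c 2 * s1), I (f * c 2 * f1),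
     [/\ I (f * c 2 * c 1) & I (f * c 2 * c 4)] &
     [/\ I (f * c 2 * (b 3 - b 2)), I (f * c 2 * (c 2 * b 1 - c 3 * b 4)) &
        I (f * c 2 * b 2 ^+ d)]].
Proof.
have [gs1 gf1 [_ gc2 gc3 _] [k1 k2 k3] [k4 k5]] := mayr_meyer1_gens JI.
move=> sc2.
split; [| | | split | split].
- by apply: (ideal_comb1 (a := f) idI sc2); ring.
- by apply: (ideal_comb2 (a1 := f * c 2) (a2 := f * c 1) idI gs1 sc2); ring.
- by apply: (ideal_comb2 (a1 := f * c 2) (a2 := f * c 4) idI gf1 sc2); ring.
- by apply: (ideal_comb2 (a1 := c 2) (a2 := c 2) idI k1 sc2); ring.
- by apply: (ideal_comb2 (a1 := c 2) (a2 := c 3) idI k2 sc2); ring.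
- by apply: (ideal_comb1 (a := - 1) idI k5); ring.
- by apply: (ideal_comb1 (a := c 2) idI k4); ring.
- by apply: (ideal_comb2 (a1 := - 1) (a2 := 1) idI gc2 sc2); ring.
Qed.

Lemma colon_sc2 : I (s * c 2 * (b 1 ^+ d - b 2 ^+ d)) ->
  [/\ [/\ I (s * c 2 * (s - f * b 1 ^+ d)),
      I (s * c 2 * (s1 - f * b 1 ^+ d * (c 2 * b 1 ^+ d))) &
      I (s * c 2 * (f1 - f * b 1 ^+ d * (c 2 * b 1 ^+ d)))],
     [/\ I (s * c 2 * (c 1 - c 2 * b 1 ^+ d)), I (s * c 2 * (c 3 - c 2)) &
      I (s * c 2 * (c 4 - c 2 * b 1 ^+ d))] &
     I (s * c 2 * (b 3 - b 2)) /\ I (s * c 2 * (b 4 - b 1))].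
Proof.
have [gs1 gf1 [gc1 gc2 gc3 _] [k1 k2 k3] [k4 k5]] := mayr_meyer1_gens JI.
move=> g.
have hs : I (s * c 2 * (s - f * b 1 ^+ d)).
  by apply: (ideal_comb2 (a1 := s) (a2 := - f) idI gc2 g); ring.
have hc1 : I (s * c 2 * (c 1 - c 2 * b 1 ^+ d)).
  by apply: (ideal_comb2 (a1 := c 2) (a2 := c 2 * b 1 ^+ d) idI gc1 k1); ring.
have h14 : I (f * (c 1 - c 4)).
  by apply: (ideal_comb3 (a1 := 1) (a2 := - 1) (a3 := - 1) idI k1 k2 k3); ring.
have hc4 : I (s * c 2 * (c 4 - c 2 * b 1 ^+ d)).
  by apply: (ideal_comb3 (a1 := 1) (a2 := c 1 - c 4) (a3 := - c 1) idI hc1 k1 h14); ring.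
have hb3 : I (s * c 2 * (b 3 - b 2)).
  by apply: (ideal_comb2 (a1 := b 3 - b 2) (a2 := - b 2 ^+ d) idI gc2 k5); ring.
have hb3d : I (f * c 2 * (b 3 ^+ d - b 2 ^+ d)).
  rewrite -opprB mulrN; apply: (ideal_N idI); rewrite subrXX mulrA.
  exact: ideal_Mr.
split; split=> //.
- by apply: (ideal_comb3 (a1 := s * c 2) (a2 := c 1) (a3 := f * b 1 ^+ d) idI gs1 hs hc1); ring.
- by apply: (ideal_comb3 (a1 := s * c 2) (a2 := c 4) (a3 := f * b 1 ^+ d) idI gf1 hs hc4); ring.
- by apply: (ideal_comb1 (a := c 2) idI k3); ring.
- have h34 : I (s * c 3 * b 4 - f * c 2 * b 1 * b 3 ^+ d).
    by apply: (ideal_comb2 (a1 := b 4) (a2 := - b 3 ^+ d) idI gc3 k4); ring.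
  have h24 : I (s * c 2 * b 4 - f * c 2 * b 1 * b 3 ^+ d).
    by apply: (ideal_comb2 (a1 := 1) (a2 := - b 4) idI h34 k3); ring.
  by apply: (ideal_comb3 (a1 := 1) (a2 := b 1) (a3 := - b 1) idI h24 hb3d gc2); ring.
Qed.
End Relations.

(** ** The shape of the minimal primes *)

Lemma subst_congr I a0 a1 a2 a3 a4 a5 a6 a7 a8 a9 a10 a11 : is_ideal I ->
    I (s - a0) -> I (f - a1) -> I (s1 - a2) -> I (f1 - a3) ->
    I (c 1 - a4) -> I (c 2 - a5) -> I (c 3 - a6) -> I (c 4 - a7) ->
    I (b 1 - a8) -> I (b 2 - a9) -> I (b 3 - a10) -> I (b 4 - a11) ->
  forall x, I (x - subst [:: a0; a1; a2; a3; a4; a5; a6; a7; a8; a9; a10; a11] x).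
Proof.
move=> idI h0 h1 h2 h3 h4 h5 h6 h7 h8 h9 h10 h11; set l := [:: a0, _ & _].
apply: (mpoly_rmorph_congr (F := idfun) (G := subst l)) => //= [u | i].
  by rewrite /subst mmapC.
rewrite -{1}(inord_val i) -[in subst _ _](inord_val i) substX //.
by case: i; do 12? [case=> [//|]].
Qed.

(** A form of the exponent of ['X_(inord k)] whose entries compute. *)
Let V (k : nat) : 'X_{1..12} := [multinom ((k == j) : nat) | j < 12].

Lemma varE k : (k < 12)%N -> 'X_(inord k) = 'X_[V k] :> R.
Proof.
move=> k12; congr 'X_[_]; apply/mnmP => j.
by rewrite mnm1E mnmE -val_eqE /= inordK.
Qed.

(** The parametrisation of the hypersurface [c2 * b1 = c3 * b4] by
    [c3 = c2 * t] and [b1 = b4 * t], where [t] is called [c3]. *)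
Definition toric : seq R :=
  [:: s; f; s1; f1; c 1; c 2; c 2 * c 3; c 4; b 4 * c 3; b 2; b 3; b 4].

(** The fibres of this parametrisation on monomials come from trading factors
    [c 2 * b 1] for [c 3 * b 4].  A monomial divisible by [b 2 ^+ n] has its
    preimages divisible by it too. *)
Lemma toric_ideal I n : is_ideal I -> I (c 2 * b 1 - c 3 * b 4) -> I (b 2 ^+ n) ->
  preim_principal (subst toric) (b 2 ^+ n) `<=` I.
Proof.
move=> idI Ih Ib x px.
(* c 2, c 3, b 1, b 2, b 4 have indices 5, 6, 8, 9, 11. *)
pose E i j : nat := match i with
  6 => ((5 == j) + (6 == j))%N | 8 => ((11 == j) + (6 == j))%N | _ => (i == j) : nat end.
pose e (i : 'I_12) : 'X_{1..12} := [multinom E i j | j < 12].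
have eE : (fun i : 'I_12 => toric`_i) = (fun i => 'X_[e i]).
  apply/funext => i; rewrite /toric.
  have mk k (m : 'X_{1..12}) : (k < 12)%N -> (forall j, V k j = m j) ->
      'X_(inord k) = 'X_[m] :> R.
    by move=> k12 km; rewrite varE //; congr 'X_[_]; apply/mnmP.
  have mk2 k k' (m : 'X_{1..12}) : (k < 12)%N -> (k' < 12)%N ->
      (forall j, (V k + V k')%MM j = m j) ->
      'X_(inord k) * 'X_(inord k') = 'X_[m] :> R.
    by move=> k12 k12' km; rewrite !varE // -mpolyXD; congr 'X_[_]; apply/mnmP.
  case: i; do 12? [case=> [lt|]] => //; rewrite [LHS]/=;
    by [apply: mk => // j; rewrite !mnmE | apply: mk2 => // j; rewrite !mnmE].
pose image (m : 'X_{1..12}) := (\sum_(i < 12) e i *+ m i)%MM.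
have imageE m k : (k < 12)%N -> image m (inord k) =
    (let F i := E i k * m (inord i) in
    F 0 + F 1 + F 2 + F 3 + F 4 + F 5 + F 6 + F 7 + F 8 + F 9 + F 10 + F 11)%N.
  move=> k12; set F := fun i => _; transitivity (\sum_(i < 12) F i)%N.
    rewrite /image mnm_sumE; apply: eq_bigr => i _.
    by rewrite mulmnE mnmE inordK // /F inord_val.
  by rewrite !big_ord_recr big_ord0.
have fibre m m' : image m = image m' -> (m (inord 6) <= m' (inord 6))%N ->
    I ('X_[m] - 'X_[m']).
  move=> eq_mm'.
  have M k (k12 : (k < 12)%N) := congr1 (fun m : 'X_{1..12} => m (inord k)) eq_mm'.
  have {M} := (M 0 isT, M 1 isT, M 2 isT, M 3 isT, (M 4 isT, M 5 isT, M 6 isT, M 7 isT),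
           (M 9 isT, M 10 isT, M 11 isT)).
  rewrite /= !imageE //= !mul0n !mul1n !addn0 !add0n.
  move=> [[[[[M0 M1] M2] M3] [[[M4 M5] M6] M7]] [[M9 M10] M11]] le_mm'.
  (* [m] has [k] factors [c 2 * b 1] where [m'] has [k] factors [c 3 * b 4]. *)
  pose k := (m' (inord 6) - m (inord 6))%N.
  have kE : (k + m (inord 6) = m' (inord 6))%N by rewrite subnK.
  move: k kE => k kE.
  pose w := [multinom (if (j == 5 :> nat) || (j == 8 :> nat) then m j - k else m j)%N | j < 12].
  have mw : m = (w + (V 5 *+ k + V 8 *+ k))%MM.
    apply/mnmP => j; rewrite !mnmDE !mulmnE !mnmE -[j]inord_val.
    clear - M0 M1 M2 M3 M4 M5 M6 M7 M9 M10 M11 le_mm' kE.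
    by case: j; do 12? [case=> [lt|]] => //=; rewrite ?inordK //=; lia.
  have m'w : m' = (w + (V 6 *+ k + V 11 *+ k))%MM.
    apply/mnmP => j; rewrite !mnmDE !mulmnE !mnmE -[j]inord_val.
    clear - M0 M1 M2 M3 M4 M5 M6 M7 M9 M10 M11 le_mm' kE.
    by case: j; do 12? [case=> [lt|]] => //=; rewrite ?inordK //=; lia.
  rewrite mw m'w !mpolyXD -mulrBr; apply: (ideal_Ml _ idI).
  rewrite -!mpolyXn -(@varE 5) // -(@varE 8) // -(@varE 6) // -(@varE 11) // -!exprMn.
  exact: (ideal_subrX _ idI).
apply: (@monomial_subst_ideal K 12 e I (fun m => n <= m (inord 9))%N x idI).
- move=> m m' eq_mm'; have [le|/ltnW le] := leqP (m (inord 6)) (m' (inord 6)).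
    exact: fibre.
  by rewrite -opprB; apply: (ideal_N idI); apply: fibre.
- move=> m; rewrite -/(image m) imageE //= !mul0n !mul1n !addn0 !add0n => le_nm.
  have /submK <- : (V 9 *+ n <= m)%MM.
    apply/mnm_lepP => j; rewrite mulmnE mnmE; case: eqP => [e9 | _] //.
    by rewrite mul1n -[j]inord_val -e9.
  by rewrite mpolyXD -mpolyXn -(@varE 9) //; apply: (ideal_Ml _ idI).
case: px => a xE k; have -> : mmap (@mpolyC 12 K) (fun i => 'X_[e i]) x = a * b 2 ^+ n.
  by rewrite -eE; exact: xE.
rewrite /vb varE // mpolyXn (perm_mem (msuppMX _ _)) => /mapP[m' _ ->].
by rewrite mnmDE mulmnE mnmE inordK // mul1n leq_addr.
Qed.

(** The composition of [phi] and of [eval pt] is a zero of the whole ideal. *)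
Lemma not_preim_principal (phi : {rmorphism R -> R}) (p x : R) pt :
  eval pt p = 0 -> eval pt (phi x) != 0 -> ~ preim_principal phi p x.
Proof.
by move=> p0 + [a xE]; rewrite xE rmorphM /= p0 mulr0 eqxx.
Qed.

Lemma preim_principal_sub (phi : {rmorphism R -> R}) I p : is_ideal I ->
  (forall x, I (x - phi x)) -> I p -> preim_principal phi p `<=` I.
Proof.
move=> idI Iphi Ip x px; apply: (ideal_congr idI (Iphi x)).
exact: principal_sub px.
Qed.

Ltac mm_simpl := do 3 rewrite ?(rmorphB, rmorphM, rmorphXn) /= ?substE ?substC /=.

Ltac eval_at := mm_simpl; rewrite ?evalE ?evalC /= ?rmorph0 ?expr0n ?expr1n
  ?mul0r ?mulr0 ?mul1r ?mulr1 ?sub0r ?subr0 ?subrr ?oppr_eq0 ?oner_neq0.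

Ltac mm_gens0 := exists 0; mm_simpl; ring.

Lemma principal0_prime : is_prime (principal (0 : R)).
Proof.
apply: (principal_prime (h := idfun)) => //= x ->; exact: principal_id.
Qed.

Lemma principal_b2_prime : is_prime (principal (b 2 : R)).
Proof.
pose h := subst [:: s; f; s1; f1; c 1; c 2; c 3; c 4; b 1; 0; b 3; b 4].
have idb := principalP (b 2 : R).
apply: (principal_prime (h := h)) => [|x hx]; first by rewrite /= /h substE.
rewrite -(subr0 x) -hx; apply: subst_congr; rewrite ?subrr ?subr0 //;
  by [apply: ideal_0 | apply: principal_id].
Qed.

Lemma principal_b3_prime : is_prime (principal (b 3 : R)).
Proof.
pose h := subst [:: s; f; s1; f1; c 1; c 2; c 3; c 4; b 1; b 2; 0; b 4].
have idb := principalP (b 3 : R).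
apply: (principal_prime (h := h)) => [|x hx]; first by rewrite /= /h substE.
rewrite -(subr0 x) -hx; apply: subst_congr; rewrite ?subrr ?subr0 //;
  by [apply: ideal_0 | apply: principal_id].
Qed.

Lemma principal_line_prime z : is_prime (principal (b 1 - z%:MP * b 2 : R)).
Proof.
pose h := subst [:: s; f; s1; f1; c 1; c 2; c 3; c 4; z%:MP * b 2; b 2; b 3; b 4].
have idb := principalP (b 1 - z%:MP * b 2 : R).
apply: (principal_prime (h := h)) => [|x hx].
  by rewrite rmorphB rmorphM /= /h !substE /= /subst mmapC subrr.
rewrite -(subr0 x) -hx; apply: subst_congr; rewrite ?subrr //;
  by [apply: ideal_0 | apply: principal_id].
Qed.

(** ** Five families of minimal primes *)

(** Substitution with kernel [(s, f, s1, f1)].  The minimality of this prime and of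
    the following ones is shown by cancelling, in the generators of [J], factors
    that do not vanish at explicit points of the zero set of the prime. *)
Definition at_sf : seq R := [:: 0; 0; 0; 0; c 1; c 2; c 3; c 4; b 1; b 2; b 3; b 4].

Lemma mayr_meyer1_sub_sf : J `<=` preim_principal (subst at_sf) 0.
Proof. by apply: mayr_meyer1_sub; first exact: preim_principalP; mm_gens0. Qed.

Lemma preim_sf_sub P : is_ideal P -> J `<=` P -> P s -> P f ->
  preim_principal (subst at_sf) 0 `<=` P.
Proof.
move=> idP JP Ps Pf.
have [gs1 gf1 _ _ _] := mayr_meyer1_gens JP.
apply: preim_principal_sub => //; last exact: ideal_0.
apply: subst_congr; rewrite ?subrr ?subr0 //; try exact: ideal_0.
  by apply: (ideal_comb2 (a1 := 1) (a2 := c 1) idP gs1 Ps); ring.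
by apply: (ideal_comb2 (a1 := 1) (a2 := c 4) idP gf1 Ps); ring.
Qed.

Lemma minimal_prime_sf : minimal_prime J (preim_principal (subst at_sf) 0).
Proof.
apply: (preim_minimal_prime (n := 1)) => //; [exact: principal0_prime |
  exact: mayr_meyer1_sub_sf |].
move=> P prP JP P0; have idP := prime_ideal prP.
have [gs1 gf1 [gc1 _ _ _] [_ _ k3] _] := mayr_meyer1_gens JP.
pose pt : seq K := [:: 0; 0; 0; 0; 1; 0; 1; 1; 1; 1; 1; 1].
have nP x : eval pt (subst at_sf x) != 0 -> ~ P x.
  by move=> h /P0; apply: not_preim_principal h; rewrite rmorph0.
have Ps : P s by apply: (prime_cancel prP) k3; apply: nP; eval_at.
apply: preim_sf_sub => //.
have Psf : P (s - f * b 1 ^+ d).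
  by rewrite mulrC in gc1; apply: (prime_cancel prP) gc1; apply: nP; eval_at.
apply: (@prime_cancel _ _ _ (b 1 ^+ d) prP); first by apply: nP; eval_at.
by apply: (ideal_comb2 (a1 := 1) (a2 := - 1) idP Ps Psf); ring.
Qed.

(** Substitution with kernel [(c1, c2, c3, c4, s1, f1)]. *)
Definition at_c : seq R := [:: s; f; 0; 0; 0; 0; 0; 0; b 1; b 2; b 3; b 4].

Lemma mayr_meyer1_sub_c : J `<=` preim_principal (subst at_c) 0.
Proof. by apply: mayr_meyer1_sub; first exact: preim_principalP; mm_gens0. Qed.

Lemma preim_c_sub P : is_ideal P -> J `<=` P ->
  P (c 1) -> P (c 2) -> P (c 3) -> P (c 4) ->
  preim_principal (subst at_c) 0 `<=` P.
Proof.
move=> idP JP Pc1 Pc2 Pc3 Pc4.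
have [gs1 gf1 _ _ _] := mayr_meyer1_gens JP.
apply: preim_principal_sub => //; last exact: ideal_0.
apply: subst_congr; rewrite ?subrr ?subr0 //; try exact: ideal_0.
  by apply: (ideal_comb2 (a1 := 1) (a2 := s) idP gs1 Pc1); ring.
by apply: (ideal_comb2 (a1 := 1) (a2 := s) idP gf1 Pc4); ring.
Qed.

Lemma minimal_prime_c : minimal_prime J (preim_principal (subst at_c) 0).
Proof.
apply: (preim_minimal_prime (n := 1)) => //; [exact: principal0_prime |
  exact: mayr_meyer1_sub_c |].
move=> P prP JP P1; have idP := prime_ideal prP.
have [_ _ [gc1 gc2 gc3 gc4] _ _] := mayr_meyer1_gens JP.
pose pt : seq K := [:: 1; 0; 0; 0; 0; 0; 0; 0; 0; 0; 0; 0].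
have nP x : eval pt (subst at_c x) != 0 -> ~ P x.
  by move=> h /P1; apply: not_preim_principal h; rewrite rmorph0.
apply: preim_c_sub => //.
- by apply: (prime_cancel prP) gc1; apply: nP; eval_at.
- by apply: (prime_cancel prP) gc2; apply: nP; eval_at.
- by apply: (prime_cancel prP) gc3; apply: nP; eval_at.
- by apply: (prime_cancel prP) gc4; apply: nP; eval_at.
Qed.

(** Together with [b 3], for the prime [(s, c1, c2, c4, b3, b4, s1, f1)]. *)
Definition at_b3 : seq R := [:: 0; f; 0; 0; 0; 0; c 3; 0; b 1; b 2; b 3; 0].

Lemma mayr_meyer1_sub_b3 : J `<=` preim_principal (subst at_b3) (b 3 ^+ d).
Proof.
apply: mayr_meyer1_sub; first exact: preim_principalP; try by mm_gens0.
by exists (- c 3 * f); mm_simpl; ring.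
Qed.

Lemma minimal_prime_b3 : minimal_prime J (preim_principal (subst at_b3) (b 3)).
Proof.
apply: (preim_minimal_prime (n := d)) => //; [exact: principal_b3_prime |
  exact: mayr_meyer1_sub_b3 |].
move=> P prP JP P2; have idP := prime_ideal prP.
have [gs1 gf1 [_ gc2 gc3 _] [k1 k2 k3] [k4 _]] := mayr_meyer1_gens JP.
pose pt : seq K := [:: 0; 1; 0; 0; 0; 0; 1; 0; 1; 1; 0; 0].
have nP x : eval pt (subst at_b3 x) != 0 -> ~ P x.
  by move=> h /P2; apply: not_preim_principal h; rewrite evalE.
have nf : ~ P f by apply: nP; eval_at.
have nc3 : ~ P (c 3) by apply: nP; eval_at.
have Ps : P s by apply: (prime_cancel prP) k3; apply: nP; eval_at.
have Pc1 : P (c 1).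
  by apply: (prime_cancel prP nf); apply: (ideal_comb2 (a1 := 1) (a2 := c 2) idP k1 Ps); ring.
have Pc4 : P (c 4).
  by apply: (prime_cancel prP nf); apply: (ideal_comb2 (a1 := 1) (a2 := c 3) idP k2 Ps); ring.
have Pc2 : P (c 2).
  apply: (@prime_cancel _ _ _ (f * b 2 ^+ d) prP); first by apply: nP; eval_at.
  by apply: (ideal_comb2 (a1 := - 1) (a2 := c 2) idP gc2 Ps); ring.
have Pb4 : P (b 4).
  apply: (@prime_cancel _ _ _ (f * c 3) prP); first by apply: nP; eval_at.
  by apply: (ideal_comb2 (a1 := - 1) (a2 := f * b 1) idP k4 Pc2); ring.
have Pb3 : P (b 3).
  apply: (@primeX _ _ _ d prP).
  apply: (@prime_cancel _ _ _ (f * c 3) prP); first by apply: nP; eval_at.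
  by apply: (ideal_comb2 (a1 := - 1) (a2 := c 3) idP gc3 Ps); ring.
apply: preim_principal_sub => //.
apply: subst_congr; rewrite ?subrr ?subr0 //; try exact: ideal_0.
  by apply: (ideal_comb2 (a1 := 1) (a2 := c 1) idP gs1 Ps); ring.
by apply: (ideal_comb2 (a1 := 1) (a2 := c 4) idP gf1 Ps); ring.
Qed.

(** Followed by [toric] and together with [b 2], for the prime
    [(s, c1, c4, b2, b3, c2 * b1 - c3 * b4, s1, f1)]. *)
Definition at_b2 : seq R := [:: 0; f; 0; 0; 0; c 2; c 3; 0; b 1; b 2; b 2; b 4].

Lemma mayr_meyer1_sub_b2 : J `<=` preim_principal (subst toric \o subst at_b2) (b 2 ^+ d).
Proof.
apply: mayr_meyer1_sub; first exact: preim_principalP; try by mm_gens0.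
  by exists (- c 2 * f); mm_simpl; ring.
by exists (- c 2 * c 3 * f); mm_simpl; ring.
Qed.

Lemma preim_b2_sub I n : is_ideal I -> I s -> I s1 -> I f1 -> I (c 1) -> I (c 4) ->
  I (b 3 - b 2) -> I (c 2 * b 1 - c 3 * b 4) -> I (b 2 ^+ n) ->
  preim_principal (subst toric \o subst at_b2) (b 2 ^+ n) `<=` I.
Proof.
move=> idI Is Is1 If1 Ic1 Ic4 Ib3 Ih Ib2 x px; apply: (ideal_congr (y := subst at_b2 x) idI).
  by apply: subst_congr; rewrite ?subrr ?subr0 //; apply: ideal_0.
exact: (toric_ideal idI Ih Ib2) px.
Qed.

Lemma minimal_prime_b2 : minimal_prime J (preim_principal (subst toric \o subst at_b2) (b 2)).
Proof.
apply: (preim_minimal_prime (n := d)) => //; [exact: principal_b2_prime |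
  exact: mayr_meyer1_sub_b2 |].
move=> P prP JP P3; have idP := prime_ideal prP.
have [gs1 gf1 [_ gc2 gc3 _] [k1 k2 k3] [k4 k5]] := mayr_meyer1_gens JP.
pose pt t : seq K := [:: 0; 1; 0; 0; 0; 1; t; 0; 0; 0; 0; 0].
have nP x t : eval (pt t) (subst toric (subst at_b2 x)) != 0 -> ~ P x.
  by move=> h /P3; apply: not_preim_principal h; rewrite evalE.
have nf : ~ P f by apply: (nP _ 0); eval_at.
have nc2 : ~ P (c 2) by apply: (nP _ 0); eval_at.
have nc3 : ~ P (c 3) by apply: (nP _ 1); eval_at.
have Ps : P s by apply: (prime_cancel prP) k3; apply: (nP _ 0); eval_at.
have Pc1 : P (c 1).
  by apply: (prime_cancel prP nf); apply: (ideal_comb2 (a1 := 1) (a2 := c 2) idP k1 Ps); ring.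
have Pc4 : P (c 4).
  by apply: (prime_cancel prP nf); apply: (ideal_comb2 (a1 := 1) (a2 := c 3) idP k2 Ps); ring.
have Pb2 : P (b 2).
  apply: (@primeX _ _ _ d prP); apply: (prime_cancel prP nc2); apply: (prime_cancel prP nf).
  by apply: (ideal_comb2 (a1 := - 1) (a2 := c 2) idP gc2 Ps); ring.
have Pb3 : P (b 3).
  apply: (@primeX _ _ _ d prP); apply: (prime_cancel prP nc3); apply: (prime_cancel prP nf).
  by apply: (ideal_comb2 (a1 := - 1) (a2 := c 3) idP gc3 Ps); ring.
apply: (@preim_b2_sub P 1) => //.
- by apply: (ideal_comb2 (a1 := 1) (a2 := c 1) idP gs1 Ps); ring.
- by apply: (ideal_comb2 (a1 := 1) (a2 := c 4) idP gf1 Ps); ring.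
- exact: ideal_B.
- by apply: (prime_cancel prP nf); rewrite mulrC.
Qed.

Section Lines.
Variables (zs : seq K) (i : nat).
Hypotheses (i_gt0 : (0 < i)%N) (uniq_zs : uniq zs).
Hypothesis fac : forall x y : R, y != 0 ->
  x ^+ d - y ^+ d = \prod_(z <- zs) (x - z%:MP * y) ^+ i.

(** Together with [b 1 - z * b 2], for the primes attached to roots of unity.
    Both sides of each relation defining [J] become equal, except that
    [s - f * b 2 ^+ d] and [s - f * b 3 ^+ d] become
    [f * (b 1 ^+ d - b 2 ^+ d)]. *)
Definition at_line : seq R := [:: f * b 1 ^+ d; f; f * b 1 ^+ d * (c 2 * b 1 ^+ d);
  f * b 1 ^+ d * (c 2 * b 1 ^+ d); c 2 * b 1 ^+ d; c 2; c 2; c 2 * b 1 ^+ d;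
  b 1; b 2; b 2; b 1].

Lemma b2_neq0 : b 2 != 0 :> R.
Proof.
apply/eqP => /(congr1 (eval [:: 0; 0; 0; 0; 0; 0; 0; 0; 0; 1; 0; 0])) /eqP.
by rewrite evalE /= rmorph0 oner_eq0.
Qed.

Lemma subrXX_line z : z \in zs ->
  principal ((b 1 - z%:MP * b 2) ^+ i) (b 1 ^+ d - b 2 ^+ d : R).
Proof.
move=> zz; rewrite (fac _ b2_neq0) (big_rem z) //=.
by apply: (ideal_Mr _ (principalP _)); apply: principal_id.
Qed.

Lemma zs_neq0 z : z \in zs -> z != 0.
Proof.
move=> zz; apply/eqP => z0; have := fac 0 (oner_neq0 R).
rewrite (big_rem z) //= z0 mpolyC0 mul0r subrr !expr0n !gtn_eqF // mul0r.
by rewrite sub0r expr1n => /eqP; rewrite oppr_eq0 oner_eq0.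
Qed.

Lemma lines_neq z z' : z != z' ->
  ~ principal (b 1 - z%:MP * b 2) (b 1 - z'%:MP * b 2 : R).
Proof.
move=> ne [e /(congr1 (eval [:: 0; 0; 0; 0; 0; 0; 0; 0; z; 1; 0; 0]))].
rewrite !(rmorphB, rmorphM) /= !evalC !evalE /= !mulr1 subrr mulr0 => /eqP.
by rewrite subr_eq0 (negPf ne).
Qed.

Lemma mayr_meyer1_sub_line z : z \in zs ->
  J `<=` preim_principal (subst at_line) ((b 1 - z%:MP * b 2) ^+ i).
Proof.
move=> zz; have [e eE] := subrXX_line zz.
apply: mayr_meyer1_sub; first exact: preim_principalP; try by mm_gens0.
  exists (c 2 * f * e); rewrite -[RHS]mulrA -eE; mm_simpl; ring.
exists (c 2 * f * e); rewrite -[RHS]mulrA -eE; mm_simpl; ring.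
Qed.

Lemma preim_line_sub I p : is_ideal I -> I (s - f * b 1 ^+ d) ->
    I (s1 - f * b 1 ^+ d * (c 2 * b 1 ^+ d)) ->
    I (f1 - f * b 1 ^+ d * (c 2 * b 1 ^+ d)) ->
    I (c 1 - c 2 * b 1 ^+ d) -> I (c 3 - c 2) -> I (c 4 - c 2 * b 1 ^+ d) ->
    I (b 3 - b 2) -> I (b 4 - b 1) -> I p ->
  preim_principal (subst at_line) p `<=` I.
Proof.
move=> idI *; apply: preim_principal_sub => //.
by apply: subst_congr => //; rewrite subrr; apply: ideal_0.
Qed.

Lemma minimal_prime_line z : z \in zs ->
  minimal_prime J (preim_principal (subst at_line) (b 1 - z%:MP * b 2)).
Proof.
move=> zz; apply: (preim_minimal_prime (n := i)) => //;
  [exact: principal_line_prime | exact: mayr_meyer1_sub_line |].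
move=> P prP JP P4; have idP := prime_ideal prP.
have [gs1 gf1 [gc1 gc2 _ _] [k1 k2 k3] [k4 k5]] := mayr_meyer1_gens JP.
pose pt : seq K := [:: 0; 1; 0; 0; 0; 1; 0; 0; z; 1; 0; 0].
have nP x : eval pt (subst at_line x) != 0 -> ~ P x.
  by move=> h /P4; apply: not_preim_principal h; eval_at.
have zd : z ^+ d != 0 by rewrite expf_neq0 ?zs_neq0.
have nf : ~ P f by apply: nP; eval_at.
have nc2 : ~ P (c 2) by apply: nP; eval_at.
have h32 : P (c 3 - c 2).
  by rewrite mulrC in k3; apply: (prime_cancel prP) k3; apply: nP; eval_at.
have h41 : P (b 4 - b 1).
  apply: (prime_cancel prP nc2); apply: (prime_cancel prP nf).
  by apply: (ideal_comb2 (a1 := - 1) (a2 := - f * b 4) idP k4 h32); ring.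
have h23 : P (b 3 - b 2).
  apply: (@prime_cancel _ _ _ (f * c 2) prP); first by apply: nP; eval_at.
  by apply: (ideal_comb1 (a := - 1) idP k5); ring.
have hs1 : P (s - f * b 1 ^+ d).
  by rewrite mulrC in gc1; apply: (prime_cancel prP) gc1; apply: nP; eval_at.
have hs2 : P (s - f * b 2 ^+ d).
  by rewrite mulrC in gc2; apply: (prime_cancel prP) gc2.
have hc1 : P (c 1 - c 2 * b 1 ^+ d).
  apply: (prime_cancel prP nf).
  by apply: (ideal_comb2 (a1 := 1) (a2 := c 2) idP k1 hs1); ring.
have hc4 : P (c 4 - c 2 * b 1 ^+ d).
  apply: (prime_cancel prP nf).
  apply: (ideal_comb3 (a1 := 1) (a2 := c 3) (a3 := f * b 1 ^+ d) idP k2 hs1 h32); ring.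
have hb : P (b 1 - z%:MP * b 2).
  have [_ _ prodP] := prP.
  have : P (b 1 ^+ d - b 2 ^+ d).
    apply: (prime_cancel prP nf).
    by apply: (ideal_comb2 (a1 := - 1) (a2 := 1) idP hs1 hs2); ring.
  rewrite (fac _ b2_neq0) big_seq => Pprod; apply: contrapT => nPz.
  move: Pprod; apply: prime_nprod => // z' z'z /(primeX prP).
  have [-> //|ne] := eqVneq z' z.
  by apply: nP; eval_at; rewrite subr_eq0 eq_sym.
apply: preim_line_sub => //.
- by apply: (ideal_comb3 (a1 := 1) (a2 := c 1) (a3 := f * b 1 ^+ d) idP gs1 hs1 hc1); ring.
- by apply: (ideal_comb3 (a1 := 1) (a2 := c 4) (a3 := f * b 1 ^+ d) idP gf1 hs1 hc4); ring.
Qed.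

(** ** The intersection of the minimal components *)

Local Notation g := (s * c 2 * (b 1 ^+ d - b 2 ^+ d)).
Local Notation L := (ideal_add J (ideal_gen [set g])).

Lemma mm_component_sub (phi : {rmorphism R -> R}) p n x : (0 < n)%N ->
  is_prime (principal p) -> J `<=` preim_principal phi (p ^+ n) ->
  minimal_prime J (preim_principal phi p) ->
  (\bigcap_(C in minimal_component J) C) x -> preim_principal phi (p ^+ n) x.
Proof.
move=> n0 prp JQ minP Cx; have noeR := @mpoly_noetherian K 12.
have [C minC] := minimal_component_sub_preim noeR mayr_meyer1_ideal n0 prp JQ minP.
by apply; apply: Cx.
Qed.

Lemma L_ideal : is_ideal L.
Proof. by apply: ideal_addP; [exact: mayr_meyer1_ideal | exact: ideal_genP]. Qed.

Lemma Lg : L g.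
Proof. by apply: ideal_addr; [exact: mayr_meyer1_ideal | exact: sub_ideal_gen]. Qed.

Lemma JL : J `<=` L.
Proof. by apply: ideal_addl; exact: ideal_genP. Qed.

Lemma L_sub I : is_ideal I -> J `<=` I -> I g -> L `<=` I.
Proof. by move=> idI JI Ig; apply: ideal_add_sub => //; apply: ideal_gen_sub => // _ ->. Qed.

(** Let [P] be the radical of a minimal component [C].  Since [f * g] is in [J],
    [g] is in [C] unless [f] is in [P].  In that case [P] contains [(s, f)], hence
    equals it, or else it contains all the [c j] and therefore equals the prime
    they span, which does not contain [f]. *)
Lemma L_sub_bigcap : L `<=` \bigcap_(C in minimal_component J) C.
Proof.
move=> x Lx C minC; move: x Lx; apply: L_sub.
- by have [] := minimal_componentP minC; case.
- by have [] := minimal_componentP minC.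
have [prC JC [prP JP minP]] := minimal_componentP minC; have idC := primary_ideal prC.
have [_ _ [gc1 gc2 gc3 gc4] [k1 k2 k3] _] := mayr_meyer1_gens JC.
have [Pf | nPf] := pselect (radical C f); last first.
  apply: (primary_cancel prC nPf).
  have h : C (s * c 2 * f * b 1 ^+ d - s * s * c 2).
    by apply: (ideal_comb3 (a1 := - f * b 1 ^+ d) (a2 := - f) (a3 := s) idC k1 gc1 k1); ring.
  by apply: (ideal_comb2 (a1 := 1) (a2 := s) idC h gc2); ring.
have [_ _ [pc1 pc2 pc3 pc4] _ _] := mayr_meyer1_gens JP.
have idP := prime_ideal prP.
have [Ps | nPs] := pselect (radical C s).
  have P0 : preim_principal (subst at_sf) 0 = radical C.
    apply: minP; last exact: preim_sf_sub idP JP Ps Pf.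
      exact: preim_principal_prime principal0_prime.
    exact: mayr_meyer1_sub_sf.
  have Cs : C s.
    apply: (primary_cancel prC) k3; rewrite -P0.
    apply: (@not_preim_principal _ _ _ [:: 0; 0; 0; 0; 0; 0; 1; 0; 0; 0; 0; 0]).
      by rewrite rmorph0.
    by eval_at.
  by rewrite -mulrA; apply: ideal_Mr.
have Pc j : radical C (c j * (s - f * b j ^+ d)) -> radical C (c j).
  move=> h; apply: (prime_cancel prP nPs).
  by apply: (ideal_comb2 (a1 := 1) (a2 := c j * b j ^+ d) idP h Pf); ring.
have P1 : preim_principal (subst at_c) 0 = radical C.
  apply: minP; last by apply: (preim_c_sub idP JP); apply: Pc.
    exact: preim_principal_prime principal0_prime.
  exact: mayr_meyer1_sub_c.
case: (@not_preim_principal (subst at_c) 0 f [:: 0; 1; 0; 0; 0; 0; 0; 0; 0; 0; 0; 0]).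
- by rewrite rmorph0.
- by eval_at.
- by rewrite P1.
Qed.

(** An element of the first prime is [s * a1 + f * a2] modulo [J].  Substituting 0
    for the [c j] in the coefficients gives [s * a1' + f * a2'], which is 0 if the
    element is also in the second prime; so it only remains to note that
    [s * (a1 - a1')] and [f * (a2 - a2')] lie in the ideal on the right. *)
Lemma descend_fc :
  preim_principal (subst at_sf) 0 `&` preim_principal (subst at_c) 0 `<=`
  ideal_add (ideal_add J (principal (f * c 2))) (principal (f * c 3)).
Proof.
move=> x [x0 x1].
have idJ := mayr_meyer1_ideal; have idI := principal_add_ideal (f * c 2) idJ.
set M := ideal_add _ _; have idM : is_ideal M := principal_add_ideal (f * c 3) idI.
have JM : J `<=` M.
  exact: subset_trans (@principal_add_sub _ J (f * c 2)) (@principal_add_sub _ _ _).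
have Mfc2 : M (f * c 2) := @principal_add_sub _ _ (f * c 3) _ (principal_add_id _ idJ).
have Mfc3 : M (f * c 3) := principal_add_id _ idI.
have [[sc1 sc2 sc3 sc4] [fc1 fc4] [ss1 sf1 fs1 ff1]] := colon_sf idM JM Mfc2 Mfc3.
have idIs := principal_add_ideal s idJ.
pose N := ideal_add (ideal_add J (principal s)) (principal f).
have idN : is_ideal N := principal_add_ideal f idIs.
have JN : J `<=` N.
  exact: subset_trans (@principal_add_sub _ J s) (@principal_add_sub _ _ _).
have Ns : N s := @principal_add_sub _ _ f _ (principal_add_id _ idJ).
have Nf : N f := principal_add_id _ idIs.
have Nx : N x := preim_sf_sub idN JN Ns Nf x0.
have congr_colon y : M (y * s1) -> M (y * f1) -> M (y * c 1) -> M (y * c 2) ->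
    M (y * c 3) -> M (y * c 4) -> forall t, M (y * (t - subst at_c t)).
  move=> *; apply: (subst_congr (I := colon M y)); rewrite ?subrr ?subr0 //;
    try exact: colonP; by apply: ideal_0; apply: colonP.
have [u [v [[j [w [Jj [a1 wE] uE]]] [a2 vE] xE]]] := Nx.
rewrite {}vE {}uE {}wE in xE.
have [[e xe] [e' je']] := (x1, mayr_meyer1_sub_c Jj).
have e0 : subst at_c a1 * s + subst at_c a2 * f = 0.
  by move: xe; rewrite xE !rmorphD !rmorphM /= je' !substE /= !mulr0 add0r.
have -> : x = j + (s * (a1 - subst at_c a1) + f * (a2 - subst at_c a2)).
  rewrite xE -[LHS]subr0 -[in X in _ - X]e0; ring.
apply: (ideal_D idM); first exact: JM.
by apply: (ideal_D idM); apply: congr_colon.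
Qed.

Lemma descend_b3 x : preim_principal (subst at_b3) (b 3 ^+ d) x ->
  ideal_add (ideal_add J (principal (f * c 2))) (principal (f * c 3)) x ->
  ideal_add J (principal (f * c 2)) x.
Proof.
set I := ideal_add J _ => Qx Mx.
have idI : is_ideal I by apply: principal_add_ideal; exact: mayr_meyer1_ideal.
have JI : J `<=` I by apply: principal_add_sub.
have Ifc2 : I (f * c 2) := principal_add_id _ mayr_meyer1_ideal.
have [is_ is1 if1 [ic1 ic2 ic4] [ib4 ib3]] := colon_fc3 idI JI Ifc2.
apply: (ideal_add_regular idI _ _ _ _ Mx Qx); first exact: preim_principalP.
- apply: ideal_add_sub; [exact: preim_principalP | exact: mayr_meyer1_sub_b3 |].
  by apply: principal_sub; [exact: preim_principalP | mm_gens0].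
- move=> y; apply: (preim_principalX_regular (y := f * c 3));
    first exact: principal_b3_prime.
  apply: (@not_preim_principal (subst at_b3) (b 3) _ [:: 0; 1; 0; 0; 0; 0; 1; 0; 0; 0; 0; 0]).
    by rewrite evalE.
  by eval_at.
- have idC : is_ideal (colon I (f * c 3)) := colonP _ idI.
  apply: preim_principal_sub => //.
  by apply: subst_congr => //; rewrite ?subrr ?subr0; first [exact: ideal_0 | assumption].
Qed.

Lemma descend_b2 x : preim_principal (subst toric \o subst at_b2) (b 2 ^+ d) x ->
  ideal_add J (principal (f * c 2)) x -> ideal_add J (principal (s * c 2)) x.
Proof.
set I := ideal_add J (principal (s * c 2)) => Qx Mx.
have idI : is_ideal I by apply: principal_add_ideal; exact: mayr_meyer1_ideal.
have JI : J `<=` I by apply: principal_add_sub.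
have Isc2 : I (s * c 2) := principal_add_id _ mayr_meyer1_ideal.
have [is_ is1 if1 [ic1 ic4] [ib3 ih ib2]] := colon_fc2 idI JI Isc2.
apply: (ideal_add_regular idI _ _ _ _ _ Qx); first exact: preim_principalP.
- apply: ideal_add_sub; [exact: preim_principalP | exact: mayr_meyer1_sub_b2 |].
  by apply: principal_sub; [exact: preim_principalP | mm_gens0].
- move=> y; apply: (preim_principalX_regular (y := f * c 2));
    first exact: principal_b2_prime.
  apply: (@not_preim_principal (subst toric \o subst at_b2) (b 2) _
    [:: 0; 1; 0; 0; 0; 1; 0; 0; 0; 0; 0; 0]).
    by rewrite evalE.
  by eval_at.
- have idC : is_ideal (colon I (f * c 2)) := colonP _ idI.
  exact: preim_b2_sub.
- exact: principal_add_mono Mx.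
Qed.

Lemma descend_line x : (forall z, z \in zs ->
    preim_principal (subst at_line) ((b 1 - z%:MP * b 2) ^+ i) x) ->
  ideal_add J (principal (s * c 2)) x -> L x.
Proof.
move=> Qx Mx.
have [[is_ is1 if1] [ic1 ic3 ic4] [ib3 ib4]] := colon_sc2 L_ideal JL Lg.
pose Q := \bigcap_(z in [set` zs]) preim_principal (subst at_line) ((b 1 - z%:MP * b 2) ^+ i).
have idQ : is_ideal Q by apply: bigcap_ideal => z _; exact: preim_principalP.
apply: (ideal_add_regular (g := s * c 2) L_ideal idQ _ _ _ _ Qx).
- apply: L_sub => // [y Jy z zz | z zz]; first exact: mayr_meyer1_sub_line.
  have [e eE] := subrXX_line zz.
  exists (f * b 1 ^+ d * c 2 * e); rewrite -[RHS]mulrA -eE; mm_simpl; ring.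
- move=> y Qy z zz; have := Qy z zz; apply: (preim_principalX_regular (y := s * c 2));
    first exact: principal_line_prime.
  apply: (@not_preim_principal (subst at_line) _ _ [:: 0; 1; 0; 0; 0; 1; 0; 0; z; 1; 0; 0]).
    by eval_at.
  by eval_at; rewrite expf_neq0 ?zs_neq0.
- move=> y Qy; have idC : is_ideal (colon L (s * c 2)) := colonP _ L_ideal.
  apply: (preim_line_sub idC (p := b 1 ^+ d - b 2 ^+ d)) => //; first exact: Lg.
  rewrite (fac _ b2_neq0); apply: principal_prod => //.
  + by move=> z _; exact: principal_line_prime.
  + by move=> z z' _ _; exact: lines_neq.
- apply: principal_add_mono Mx; [exact: L_ideal | exact: JL].
Qed.

Lemma bigcap_minimal_component : \bigcap_(C in minimal_component J) C = L.
Proof.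
apply/seteqP; split; last exact: L_sub_bigcap.
move=> x Cx; apply: descend_line.
  move=> z zz; apply: (mm_component_sub i_gt0) Cx;
    [exact: principal_line_prime | exact: mayr_meyer1_sub_line | exact: minimal_prime_line].
apply: descend_b2.
  by apply: (mm_component_sub d_gt0) Cx;
    [exact: principal_b2_prime | exact: mayr_meyer1_sub_b2 |
     exact: minimal_prime_b2].
apply: descend_b3.
  by apply: (mm_component_sub d_gt0) Cx;
    [exact: principal_b3_prime | exact: mayr_meyer1_sub_b3 |
     exact: minimal_prime_b3].
apply: descend_fc; split.
  by apply: (mm_component_sub (n := 1)) Cx;
    [| exact: principal0_prime | exact: mayr_meyer1_sub_sf |
     exact: minimal_prime_sf].
by apply: (mm_component_sub (n := 1)) Cx;
    [| exact: principal0_prime | exact: mayr_meyer1_sub_c |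
     exact: minimal_prime_c].
Qed.

End Lines.
End MayrMeyer.

Theorem proposition4 (K : fieldType) (d d' i : nat)
    (hd : (0 < d)%N) (hdi : d = (d' * i)%N)
    (hcharp : forall p : nat, p \in [pchar K] ->
       (exists e : nat, i = (p ^ e)%N) /\ coprime d' p)
    (hchar0 : [pchar K] =i pred0 -> d' = d /\ i = 1%N)
    (hroots : contains_roots_of_unity K (d %/ i)) :
  \bigcap_(C in minimal_component (mayr_meyer1 K d)) C
  = ideal_add (mayr_meyer1 K d)
      (ideal_gen [set vs K * vc K 2 * (vb K 1 ^+ d - vb K 2 ^+ d)]).
Proof.
have i_gt0 : (0 < i)%N by move: hd; rewrite hdi muln_gt0 => /andP[].
have [zs uniq_zs fac] := subrXX_factor (@mpolyC 12 K) hd hdi hcharp hchar0 hroots.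
exact: (bigcap_minimal_component hd i_gt0 uniq_zs fac).
Qed.
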